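(* Consider the network with 2 CUs, 2 eRRHs and 2 CPs under a non-oblivious stationary randomized (NSR) policy with parameters $b_k^{(n)}$, $r_1\ge r_2$ and threshold $z$. Then the average AoI of the eRRHs has the closed form $$L_e=\frac14\sum_{n=1}^{2}\sum_{k=1}^{2}\sum_{\phi\in\mathcal{G}_n^z}F_{nk}(\phi)\,\pi_\phi,$$ where, for each $n$, $\pi=(\pi_\phi)_{\phi\in\mathcal{G}_n^z}$ is the steady-state distribution determined by the transition probability matrix $\mathbf{P}$ given in the context, and $F_{nk}$ is given by the linear system $$F_{nk}(\phi)=1+\sum_{\phi'\in\mathcal{G}_n^z\setminus\mathcal{G}_{n,down,k}}\mathbf{P}_{\phi\phi'}F_{nk}(\phi'),\qquad \phi\in\mathcal{G}_n^z,$$ with $\mathcal{G}_{n,down,k}=\{\phi\in\mathcal{G}_n^z:\phi_k=1\}$.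
   Context: Time is slotted, $t=0,1,2,\dots$; $m,n,k\in\{1,2\}$ index content users (CUs), eRRHs and content providers (CPs). Policy parameters: $b_k^{(n)}\in[0,1]$ with $b_k=b_k^{(1)}+b_k^{(2)}\le1$; $r_1\ge r_2$ in $[0,1]$; $b=b_1+b_2\le B$ and $r=r_1+r_2\le R$ for given resource bounds $B,R$; a predefined integer threshold $z$. Put $\zeta_{nk}=1-(1-b_k^{(n)})^2$. In slot $t$, $\beta_{mk}^{(n)}(t)\in\{0,1\}$ indicates that CU $m$ sends a request for CP $k$ to eRRH $n$; $\sum_n\beta_{mk}^{(n)}(t)\le1$, $\Pr(\beta_{mk}^{(n)}(t)=1)=b_k^{(n)}$, and decisions of different CUs $m$ are independent. Upon receiving at least one request for CP $k$, eRRH $n$ either commands CP $k$ to send a new packet ($\gamma_{nk}(t)=1$) or uses its cached packet ($\gamma_{nk}(t)=0$); the $\gamma_{nk}(t)$ are independent over $n$ and over $k$, and $\Pr(\gamma_{nk}(t)=1)=r_{nk}(t)$, where $r_{nk}(t)=r_k$ if $g_{n1}(t)\ge g_{n2}(t)$ and $g_{n2}(t)<z$; $r_{nk}(t)=r-r_k$ if $g_{n1}(t)<g_{n2}(t)$ and $g_{n1}(t)<z$; $r_{nk}(t)=r/2$ if $g_{n1}(t)\ge z$ and $g_{n2}(t)\ge z$. AoI at the eRRHs: $g_{nk}(0)=1$; $g_{nk}(t+1)=1$ if $\gamma_{nk}(t)\sum_m\beta_{mk}^{(n)}(t)>0$, which happens with probability $r_{nk}(t)\zeta_{nk}$, and $g_{nk}(t+1)=g_{nk}(t)+1$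 otherwise. The average AoI of the eRRHs is $L_e=\lim_{T\to\infty}\frac1T\sum_{t=1}^T\frac14\sum_{n=1}^2\sum_{k=1}^2\mathbb{E}[g_{nk}(t)]$. Truncated chain: $G_n^z(t)=(g_{n1}^z(t),g_{n2}^z(t))$, where $g_{nk}^z(t+1)=1$ with probability $r_{nk}(t)\zeta_{nk}$ and $g_{nk}^z(t+1)=\min\{g_{nk}^z(t)+1,z\}$ with probability $1-r_{nk}(t)\zeta_{nk}$. It is a Markov process with a unique steady-state distribution, and its state space $\mathcal{G}_n^z$ consists of the $z^2$ pairs $\phi=(\phi_1,\phi_2)\in\{1,\dots,z\}^2$. $F_{nk}(\phi)$ is the expected time until eRRH $n$ next receives a new packet from CP $k$, given $G_n^z(t)=\phi$. Transition matrix $\mathbf{P}$: write $r_0=r/2$, $\bar r_j=1-r_j$ ($j=0,1,2$), $\bar\zeta_{nk}=(1-b_k^{(n)})^2$, and partition the states $\phi$ into $\mathcal{G}_1^z=\{\phi_2<\phi_1\}$, $\mathcal{G}_2^z=\{\phi_1<\phi_2\}$, $\mathcal{G}_3^z=\{\phi_1=\phi_2\}$. The possible transitions $\phi\to\phi'$ are: (A) $\phi'=(1,1)$: $\mathbf{P}_{\phi\phi'}=r_0^2\zeta_{n1}\zeta_{n2}$ for $\phi\in\mathcal{G}_3^z$, and $r_1r_2\zeta_{n1}\zeta_{n2}$ for $\phi\in\mathcal{G}_1^z\cup\mathcal{G}_2^z$. (B) $\phi'=(1,\min\{\phi_2+1,z\})$: $r_0\zeta_{n1}(\bar r_0\zeta_{n2}+\bar\zeta_{n2})$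 for $\phi\in\mathcal{G}_3^z$; $r_1\zeta_{n1}(\bar r_2\zeta_{n2}+\bar\zeta_{n2})$ for $\phi\in\mathcal{G}_1^z$; $r_2\zeta_{n1}(\bar r_1\zeta_{n2}+\bar\zeta_{n2})$ for $\phi\in\mathcal{G}_2^z$. (C) $\phi'=(\min\{\phi_1+1,z\},1)$: $r_0\zeta_{n2}(\bar r_0\zeta_{n1}+\bar\zeta_{n1})$ for $\phi\in\mathcal{G}_3^z$; $r_2\zeta_{n2}(\bar r_1\zeta_{n1}+\bar\zeta_{n1})$ for $\phi\in\mathcal{G}_1^z$; $r_1\zeta_{n2}(\bar r_2\zeta_{n1}+\bar\zeta_{n1})$ for $\phi\in\mathcal{G}_2^z$. (D) $\phi'=(\min\{\phi_1+1,z\},\min\{\phi_2+1,z\})$: $(\bar r_0\zeta_{n1}+\bar\zeta_{n1})(\bar r_0\zeta_{n2}+\bar\zeta_{n2})$ for $\phi\in\mathcal{G}_3^z$; $(\bar r_1\zeta_{n1}+\bar\zeta_{n1})(\bar r_2\zeta_{n2}+\bar\zeta_{n2})$ for $\phi\in\mathcal{G}_1^z$; $(\bar r_2\zeta_{n1}+\bar\zeta_{n1})(\bar r_1\zeta_{n2}+\bar\zeta_{n2})$ for $\phi\in\mathcal{G}_2^z$.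
   Formalization: The stated policy and matrix P disagree at ties g_{n1}=g_{n2}<z, so the claim is proved for both consistent conventions (r_1,r_2 at such ties in both, or r/2 in both); and z≥2 is assumed, since for z=1 the formula would give L_e=1, which is false. *)

(* Defs.v *)
From HB Require Import structures.
From mathcomp Require Import all_boot all_order all_algebra.
From mathcomp Require Import all_classical all_reals all_analysis.

Set Implicit Arguments.
Unset Strict Implicit.
Unset Printing Implicit Defensive.

Import Order.TTheory GRing.Theory Num.Theory.
Import numFieldNormedType.Exports.

Local Open Scope classical_set_scope.
Local Open Scope ring_scope.

(* CUs, eRRHs and CPs are all indexed by 'I_2, written m, n and k. *)
Definition one : 'I_2 := ord0.
Definition two : 'I_2 := ord_max.

(* Serving rule at a tie g_{n1} = g_{n2} < z.
   The policy as stated (r_{nk}(t) = r_k if g_{n1} >= g_{n2} and g_{n2} < z)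
   treats such a tie as g_{n1} > g_{n2} and serves with (r_1, r_2); the
   transition matrix as stated uses r/2 on the whole diagonal.  These describe
   different chains unless r_1 = r_2 (or no request is ever made), so one
   convention is fixed for the process and the matrix together:
   - TieLeading : the policy as stated; the diagonal states below (z, z) are
                  counted in the region G_1 of the matrix;
   - TieEven    : the matrix as stated; the policy serves with r/2 at every
                  tie. *)
Inductive tie_rule := TieLeading | TieEven.

Definition is_even (tie : tie_rule) : bool :=
  if tie is TieEven then true else false.

Record nsr_policy (R : realType) := NSRPolicy {
  reqp : 'I_2 -> 'I_2 -> R;       (* reqp k n = b_k^(n) *)
  cmdp : 'I_2 -> R;               (* cmdp k = r_k *)
  thr : nat;                      (* z *)
  ties : tie_rule
}.

Section Policy.
Variables (R : realType) (p : nsr_policy R).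

Definition cmd_total : R := cmdp p one + cmdp p two.

(* For z = 1 every truncated age equals 1, whether or not a packet has been
   received, and G_{down,k} loses its meaning; hence 2 <= z. *)
Record valid_policy (B Rmax : R) : Prop := ValidPolicy {
  reqp_itv : forall k n, 0 <= reqp p k n <= 1;
  reqp_sum : forall k, \sum_(n < 2) reqp p k n <= 1;
  reqp_budget : \sum_(k < 2) \sum_(n < 2) reqp p k n <= B;
  cmdp_itv : forall k, 0 <= cmdp p k <= 1;
  cmdp_le : cmdp p two <= cmdp p one;
  cmdp_budget : cmd_total <= Rmax;
  thr_ge2 : (2 <= thr p)%N
}.

(* r_{nk}(t) as a function of k and of g1 = g_{n1}(t), g2 = g_{n2}(t). *)
Definition serve_prob (k : 'I_2) (g1 g2 : nat) : R :=
  if is_even (ties p) && (g1 == g2) then cmd_total / 2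
  else if (g2 <= g1)%N && (g2 < thr p)%N then cmdp p k
  else if (g1 < g2)%N && (g1 < thr p)%N then cmd_total - cmdp p k
  else cmd_total / 2.

(* Joint law of (beta_{mk}^(n)(t))_n for a given CU m and CP k: at most one
   coordinate is 1, and coordinate n is 1 with probability b_k^(n). *)
Definition request_law (k : 'I_2) (x : 'I_2 -> bool) : R :=
  if x one && x two then 0
  else if x one then reqp p k one
  else if x two then reqp p k two
  else 1 - reqp p k one - reqp p k two.

Definition bernoulli_law (q : R) (y : bool) : R := if y then q else 1 - q.

End Policy.

(* A path of requests is beta t m k n, a path of commands is gamma t n k. *)
Definition requests := nat -> 'I_2 -> 'I_2 -> 'I_2 -> bool.
Definition commands := nat -> 'I_2 -> 'I_2 -> bool.

(* g_{nk}(t) along one path. *)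
Fixpoint age (beta : requests) (gamma : commands) (n k : 'I_2) (t : nat) : nat :=
  if t is s.+1 then
    if (0 < gamma s n k * \sum_(m < 2) beta s m k n)%N then 1%N
    else (age beta gamma n k s).+1
  else 1%N.

Section Process.
Variables (R : realType) (p : nsr_policy R).
Variables (d : measure_display) (Omega : measurableType d).
Variable Pr : probability Omega R.
Variable beta : Omega -> requests.
Variable gamma : Omega -> commands.

Definition past (t : nat) (x : requests) (y : commands) : set Omega :=
  [set w | forall s, (s < t)%N ->
     (forall m k n, beta w s m k n = x s m k n) /\
     (forall n k, gamma w s n k = y s n k)].

Definition present (t : nat) (x : requests) (y : commands) : set Omega :=
  [set w | (forall m k n, beta w t m k n = x t m k n) /\
           (forall n k, gamma w t n k = y t n k)].

(* In each slot, given the whole past, the requests are independent over CUs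
   and CPs and follow the (stationary) law above; the commands are independent
   of them and over n and k, gamma_{nk}(t) being Bernoulli with parameter
   r_{nk}(t), which is a function of the past.  The value of gamma_{nk}(t) in a
   slot without a request for CP k at eRRH n has no effect on the ages. *)
Record nsr_process : Prop := NSRProcess {
  beta_meas : forall t m k n, measurable [set w | beta w t m k n];
  gamma_meas : forall t n k, measurable [set w | gamma w t n k];
  beta_once : forall w t m k, (\sum_(n < 2) beta w t m k n <= 1)%N;
  slot_law : forall t x y,
    Pr (past t x y `&` present t x y) =
    (Pr (past t x y) *
     ((\prod_(m < 2) \prod_(k < 2) request_law p k (x t m k)) *
      (\prod_(n < 2) \prod_(k < 2)
         bernoulli_law (serve_prob p k (age x y n one t) (age x y n two t))
                       (y t n k)))%:E)%E
}.

Definition AoI (n k : 'I_2) (t : nat) (w : Omega) : nat :=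
  age (beta w) (gamma w) n k t.

(* (1/T) sum_{t=1}^T (1/4) sum_{n,k} E[g_{nk}(t)]; L_e is its limit. *)
Definition mean_AoI (T : nat) : \bar R :=
  ((T%:R^-1)%:E * \sum_(1 <= t < T.+1)
     ((4^-1)%:E * \sum_(n < 2) \sum_(k < 2)
        'E_Pr [fun w => (AoI n k t w)%:R]))%E.

(* Number of slots, counted from t, until eRRH n next receives a new packet
   from CP k (+oo if it never does). *)
Definition recv_delay (n k : 'I_2) (t : nat) (w : Omega) : \bar R :=
  ereal_inf [set (s%:R)%:E | s in
    [set s : nat | (0 < s)%N /\ AoI n k (t + s) w = 1%N]].

End Process.

(* phi : state z represents (phi_1, phi_2) in {1, ..., z}^2 through
   phi_k = (phi k).+1, the ordinals of 'I_z starting from 0. *)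
Definition state (z : nat) := {ffun 'I_2 -> 'I_z}.

Definition sage (z : nat) (phi : state z) (k : 'I_2) : nat := (phi k).+1.

Definition down (z : nat) (k : 'I_2) : {set state z} :=
  [set phi : state z | sage phi k == 1%N].

Section Chain.
Variables (R : realType) (p : nsr_policy R) (n : 'I_2).
Local Notation z := (thr p).
Local Notation St := (state (thr p)).

Definition region1 : {set St} :=
  [set phi : St | (sage phi two < sage phi one)%N ||
     [&& ~~ is_even (ties p), sage phi one == sage phi two
       & (sage phi one < z)%N]].
Definition region2 : {set St} :=
  [set phi : St | (sage phi one < sage phi two)%N].

Definition zetabar (k : 'I_2) : R := (1 - reqp p k n) ^+ 2.
Definition zeta (k : 'I_2) : R := 1 - zetabar k.

(* Outside regions 1 and 2 lies region 3. *)
Definition by_region (phi : St) (x3 x1 x2 : R) : R :=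
  if phi \in region1 then x1 else if phi \in region2 then x2 else x3.

(* The four targets are distinct because 2 <= z. *)
Definition trans (phi phi' : St) : R :=
  let r0 := cmd_total p / 2 in
  let r1 := cmdp p one in let r2 := cmdp p two in
  let r0' := 1 - r0 in let r1' := 1 - r1 in let r2' := 1 - r2 in
  let z1 := zeta one in let z2 := zeta two in
  let z1' := zetabar one in let z2' := zetabar two in
  let up k := minn (sage phi k).+1 z in
  let target := (sage phi' one, sage phi' two) in
  if target == (1%N, 1%N) then
    by_region phi (r0 ^+ 2 * z1 * z2) (r1 * r2 * z1 * z2) (r1 * r2 * z1 * z2)
  else if target == (1%N, up two) then
    by_region phi (r0 * z1 * (r0' * z2 + z2'))
                  (r1 * z1 * (r2' * z2 + z2'))
                  (r2 * z1 * (r1' * z2 + z2'))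
  else if target == (up one, 1%N) then
    by_region phi (r0 * z2 * (r0' * z1 + z1'))
                  (r2 * z2 * (r1' * z1 + z1'))
                  (r1 * z2 * (r2' * z1 + z1'))
  else if target == (up one, up two) then
    by_region phi ((r0' * z1 + z1') * (r0' * z2 + z2'))
                  ((r1' * z1 + z1') * (r2' * z2 + z2'))
                  ((r2' * z1 + z1') * (r1' * z2 + z2'))
  else 0.

Definition steady_state (pi : {ffun St -> R}) : Prop :=
  [/\ forall phi, 0 <= pi phi,
      \sum_phi pi phi = 1
    & forall phi', \sum_phi pi phi * trans phi phi' = pi phi'].

(* Probability that the chain started at phi then visits the states of s. *)
Fixpoint path_prob (phi : St) (s : seq St) : R :=
  if s is phi' :: s' then trans phi phi' * path_prob phi' s' else 1.

(* Probability that no packet from CP k is received in the first j slots. *)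
Definition no_recv_prob (k : 'I_2) (j : nat) (phi : St) : R :=
  \sum_(s : j.-tuple St | all (fun x => x \notin down z k) s) path_prob phi s.

(* F_{nk}(phi), as E[tau] = sum_{j >= 0} Pr(tau > j); possibly +oo. *)
Definition recv_time (k : 'I_2) (phi : St) : \bar R :=
  (\sum_(0 <= j <oo) (no_recv_prob k j phi)%:E)%E.

(* In \bar R, 0 * +oo = 0. *)
Definition recv_system (k : 'I_2) (F : St -> \bar R) : Prop :=
  forall phi, F phi =
    (1 + \sum_(phi' : St | phi' \notin down z k) (trans phi phi')%:E * F phi')%E.

End Chain.

(* The event G_n^z(t) = phi, with g^z_{nk}(t) = min(g_{nk}(t), z). *)
Definition in_state (R : realType) (p : nsr_policy R) (d : measure_display)
    (Omega : measurableType d) (beta : Omega -> requests)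
    (gamma : Omega -> commands) (n : 'I_2) (t : nat) (phi : state (thr p)) :
    set Omega :=
  [set w | forall k, minn (AoI beta gamma n k t w) (thr p) = sage phi k].

(* Main.v *)
(* Fix an eRRH.  Its truncated ages form a finite chain with a state that is
   reachable from every state, whatever the degenerate parameters (some
   zeta = 0, r_2 = 0, r_1 = 1).  Hence an invariant vector of total mass 0
   vanishes, so the stationary distribution is unique, and by the Fredholm
   alternative f - pi(f) = g - P g is solvable for every f, which bounds
   sum_(t < N) mu_t(f) - N pi(f) uniformly in N without any aperiodicity.

   With h_j(phi) the probability of no reception during j slots from phi, both
   quantities of the theorem are tail sums of the h_j: F = sum_j h_j, while
   "age(t) > j" means no reception during the j slots before t, so that
   E[age(t)] = sum_(j <= t) mu_(t-j)(h_j).  Averaging over t gives sum_j pi(h_j),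
   from below by keeping finitely many j, from above by telescoping with
   F = 1 + Q F when F is finite.  If F is infinite somewhere, it is infinite at
   the reachable state, which pi charges, and both sides are +oo. *)
Require Import Defs.
From HB Require Import structures.
From mathcomp Require Import all_boot all_order all_algebra.
From mathcomp Require Import all_classical all_reals all_analysis.
From mathcomp Require Import measurable_realfun ring lra zify.
Import Order.TTheory GRing.Theory Num.Theory.
Import numFieldNormedType.Exports.
(* [one] is shadowed by the analysis library. *)
Import Defs.
Local Open Scope classical_set_scope.
Local Open Scope ring_scope.

Set Implicit Arguments.
Unset Strict Implicit.
Unset Printing Implicit Defensive.

(** * Finite Markov chains *)

(** [A] is the transpose of [M], so solving for [f] means that the row [G] lies in the row space of
    [A]. The cokernel of [A] tests this, and its columns are left null vectors [v] of [M]. *)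
Lemma fredholm (R : realFieldType) (T : finType) (M : T -> T -> R) (g : T -> R) :
  (forall v : T -> R, (forall y, \sum_x v x * M x y = 0) ->
     \sum_x v x * g x = 0) ->
  exists f : T -> R, forall x, \sum_y M x y * f y = g x.
Proof.
move=> orth.
pose A := \matrix_(i < #|T|, j < #|T|) M (enum_val j) (enum_val i).
pose G := \row_(i < #|T|) g (enum_val i).
have reix (F : T -> R) : \sum_(i < #|T|) F (enum_val i) = \sum_x F x.
  by rewrite (reindex (enum_val : 'I_#|T| -> T)) //=; apply: onW_bij; exact: enum_val_bij.
have /submxP[D GDA] : (G <= A)%MS.
  rewrite submxE; apply/eqP/rowP => j; rewrite [LHS]mxE [RHS]mxE.
  pose v x := cokermx A (enum_rank x) j.
  transitivity (\sum_x v x * g x).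
    rewrite -reix; apply: eq_bigr => i _.
    by rewrite [G _ _]mxE /v enum_valK mulrC.
  apply: orth => y.
  have := congr1 (fun N : 'M[R]_(#|T|, #|T|) => N (enum_rank y) j) (mulmx_coker A).
  rewrite [LHS]mxE [RHS]mxE; apply: etrans; rewrite -reix; apply: eq_bigr => i _.
  by rewrite [A _ _]mxE /v enum_valK enum_rankK mulrC.
exists (fun y => D 0 (enum_rank y)) => x.
have := congr1 (fun N : 'rV_ _ => N 0 (enum_rank x)) GDA.
rewrite [LHS]mxE [RHS]mxE enum_rankK => ->; rewrite -[LHS]reix; apply: eq_bigr => i _.
by rewrite [A _ _]mxE enum_rankK enum_valK mulrC.
Qed.

Section Stochastic.
Context {R : realFieldType} {T : finType} (P : T -> T -> R).
Hypothesis P_ge0 : forall x y, 0 <= P x y.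
Hypothesis P_sum1 : forall x, \sum_y P x y = 1.

Definition invariant_vec (v : T -> R) := forall y, \sum_x v x * P x y = v y.

Definition leads_to : rel T := fun x y => 0 < P x y.

Lemma sum_push (v f : T -> R) :
  \sum_y (\sum_x v x * P x y) * f y = \sum_x v x * \sum_y P x y * f y.
Proof.
under eq_bigr do rewrite mulr_suml.
rewrite exchange_big /=; apply: eq_bigr => x _.
by rewrite mulr_sumr; apply: eq_bigr => y _; rewrite mulrA.
Qed.

Lemma sum_push1 (v : T -> R) : \sum_y \sum_x v x * P x y = \sum_x v x.
Proof.
rewrite exchange_big /=; apply: eq_bigr => x _.
by rewrite -mulr_sumr P_sum1 mulr1.
Qed.

(* [|v| <= |v| P] entrywise, and both sides have the same total mass. *)
Lemma invariant_norm (v : T -> R) :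
  invariant_vec v -> invariant_vec (fun x => `|v x|).
Proof.
move=> vP.
have le_y y : `|v y| <= \sum_x `|v x| * P x y.
  rewrite -(vP y) (le_trans (ler_norm_sum _ _ _))//.
  by apply: ler_sum => x _; rewrite normrM (ger0_norm (P_ge0 _ _)).
have : \sum_y (\sum_x `|v x| * P x y - `|v y|) = 0.
  by rewrite sumrB sum_push1 subrr.
move/eqP; rewrite psumr_eq0; last by move=> y _; rewrite subr_ge0.
by move=> /allP e y; have /= := e y (mem_index_enum y); rewrite subr_eq0 => /eqP.
Qed.

(** The support of a nonnegative invariant vector is closed under transitions: the single term
    [v x * P x y] already makes [v y] positive. *)
Lemma invariant_gt0 (v : T -> R) x y : (forall x, 0 <= v x) ->
  invariant_vec v -> connect leads_to x y -> 0 < v x -> 0 < v y.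
Proof.
move=> v0 vP /connectP[p + ->]; elim: p x => //= a p IH x /andP[xa pa] vx.
apply: IH => //; rewrite -vP (bigD1 x)//= ltr_pwDl ?mulr_gt0//.
by apply: sumr_ge0 => i _; rewrite mulr_ge0.
Qed.

(** If every invariant vector had mass 0, the Fredholm alternative would solve [f - P f = 1], which
    fails where [f] is minimal. So some invariant [v] has nonzero mass, and its normalized absolute
    value is stationary. [x0] makes [T] nonempty, so that a minimum exists. *)
Lemma stationary_exists (x0 : T) : exists v : T -> R,
  [/\ forall x, 0 <= v x, \sum_x v x = 1 & invariant_vec v].
Proof.
have [v [vP vn0]] : exists v : T -> R,
    (forall y, \sum_x v x * ((x == y)%:R - P x y) = 0) /\ \sum_x v x != 0.
  apply: contrapT => H.
  have [|f fE] := @fredholm R T (fun x y => (x == y)%:R - P x y) (fun=> 1).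
    move=> v vP; apply: contrapT => /eqP n0; apply: H; exists v; split => //.
    by under eq_bigr do rewrite -[v _]mulr1.
  case: (@arg_minP _ _ _ x0 xpredT f isT) => x _ xmin.
  have := fE x; under eq_bigr do rewrite mulrBl.
  rewrite sumrB (bigD1 x)//= eqxx mul1r big1 ?addr0; last first.
    by move=> i /negPf ix; rewrite eq_sym ix mul0r.
  have : f x <= \sum_y P x y * f y.
    rewrite -[leLHS]mul1r -(P_sum1 x) mulr_suml.
    by apply: ler_sum => i _; rewrite ler_wpM2l// xmin.
  lra.
have vI : invariant_vec v.
  move=> y; have := vP y; under eq_bigr do rewrite mulrBr.
  rewrite sumrB (bigD1 y)//= eqxx mulr1 big1 ?addr0; last first.
    by move=> i /negPf ->; rewrite mulr0.
  lra.
have s0 : 0 < \sum_x `|v x|.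
  by apply: lt_le_trans (ler_norm_sum _ _ _); rewrite normr_gt0.
exists (fun x => `|v x| / \sum_x `|v x|); split.
- by move=> x; rewrite mulr_ge0// invr_ge0 ltW.
- by rewrite -mulr_suml divff// gt_eqF.
- move=> y; rewrite -(invariant_norm vI y) mulr_suml.
  by apply: eq_bigr => x _; rewrite mulrAC.
Qed.

(** * Chains with a state reachable from every state *)

Section Unichain.
Variable star : T.
Hypothesis to_star : forall x, connect leads_to x star.

(** Up to sign, [v star <= 0]. Then [w], twice the positive part of [v], is invariant and vanishes
    at [star]; positive mass elsewhere would flow there. So [v <= 0], and total mass 0 leaves
    nothing. *)
Lemma invariant_sum0 (v : T -> R) :
  invariant_vec v -> \sum_x v x = 0 -> forall x, v x = 0.
Proof.
wlog v_star : v / v star <= 0.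
  move=> wl vP v0 x; have [/wl h|lt0] := leP (v star) 0; first exact: h.
  apply/eqP; rewrite -oppr_eq0; apply/eqP.
  apply: (wl (fun x => - v x)); first by rewrite oppr_le0 ltW.
    by move=> y; under eq_bigr do rewrite mulNr; rewrite sumrN vP.
  by rewrite sumrN v0 oppr0.
move=> vP v0.
pose w x := `|v x| + v x.
have w0 x : 0 <= w x by rewrite /w; have := ler_norm (- v x); rewrite normrN; lra.
have wP : invariant_vec w.
  move=> y; under eq_bigr do rewrite mulrDl.
  by rewrite big_split/= vP invariant_norm.
have vle x : v x <= 0.
  rewrite leNgt; apply/negP => vx.
  have wx : 0 < w x by rewrite addr_gt0// normr_gt0 gt_eqF.
  have := @invariant_gt0 w x star w0 wP (to_star x) wx.
  by rewrite /w (ler0_norm v_star) addNr ltxx.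
have : \sum_x - v x = 0 by rewrite sumrN v0 oppr0.
move/eqP; rewrite psumr_eq0; last by move=> i _; rewrite oppr_ge0 vle.
by move=> /allP e x; have /= := e x (mem_index_enum x); rewrite oppr_eq0 => /eqP.
Qed.

Variable pi : T -> R.
Hypothesis pi_ge0 : forall x, 0 <= pi x.
Hypothesis pi_sum1 : \sum_x pi x = 1.
Hypothesis pi_inv : invariant_vec pi.

Lemma invariant_unique (v : T -> R) :
  \sum_x v x = 1 -> invariant_vec v -> forall x, v x = pi x.
Proof.
move=> v1 vP x; apply/eqP; rewrite -subr_eq0; apply/eqP.
apply: (@invariant_sum0 (fun x => v x - pi x)).
  by move=> y; under eq_bigr do rewrite mulrBl; rewrite sumrB vP pi_inv.
by rewrite sumrB v1 pi_sum1 subrr.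
Qed.

Lemma stationary_star_gt0 : 0 < pi star.
Proof.
have [x pix] : exists x, 0 < pi x.
  apply: contrapT => /forallNP H.
  have : \sum_x pi x <= 0 by apply: sumr_le0 => x _; rewrite leNgt; apply/negP.
  by rewrite pi_sum1 ler10.
exact: invariant_gt0 (to_star x) pix.
Qed.

(** Left null vectors of [1 - P] are multiples of [pi], and [pi] annihilates the centered function
    [f - pi(f)], so the Fredholm alternative applies. *)
Lemma poisson_equation (f : T -> R) : exists g : T -> R, forall x,
  f x - \sum_y pi y * f y = g x - \sum_y P x y * g y.
Proof.
pose c := \sum_y pi y * f y.
have [|g gE] := @fredholm R T (fun x y => (x == y)%:R - P x y) (fun x => f x - c).
  move=> v vP.
  have vI : invariant_vec v.
    move=> y; have := vP y; under eq_bigr do rewrite mulrBr.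
    rewrite sumrB (bigD1 y)//= eqxx mulr1 big1 ?addr0; last first.
      by move=> i /negPf ->; rewrite mulr0.
    lra.
  pose s := \sum_x v x.
  have vE x : v x = s * pi x.
    apply/eqP; rewrite -subr_eq0; apply/eqP.
    apply: (@invariant_sum0 (fun x => v x - s * pi x)).
      move=> y; under eq_bigr do rewrite mulrBl -mulrA.
      by rewrite sumrB vI -mulr_sumr pi_inv.
    by rewrite sumrB -mulr_sumr pi_sum1 mulr1 subrr.
  under eq_bigr do rewrite vE mulrBr -mulrA.
  by rewrite sumrB -mulr_sumr -mulr_suml -mulr_sumr pi_sum1 mulr1 subrr.
exists g => x; rewrite -/c -gE; under eq_bigr do rewrite mulrBl.
rewrite sumrB (bigD1 x)//= eqxx mul1r big1 ?addr0//.
by move=> i /negPf ix; rewrite eq_sym ix mul0r.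
Qed.

Variable mu : nat -> T -> R.
Hypothesis mu_ge0 : forall t x, 0 <= mu t x.
Hypothesis mu_sum1 : forall t, \sum_x mu t x = 1.
Hypothesis mu_step : forall t y, mu t.+1 y = \sum_x mu t x * P x y.

(** By the Poisson equation the sum telescopes to [mu_a(g) - mu_(a+N)(g)], hence a bound that
    depends neither on [N] nor on the starting time [a]. *)
Lemma ergodic_bound (f : T -> R) : exists C, forall a N,
  `|\sum_(t < N) (\sum_x mu (a + t) x * f x) - N%:R * \sum_x pi x * f x| <= C.
Proof.
have [g gE] := poisson_equation f.
pose K := \sum_x `|g x|.
have mub t : `|\sum_x mu t x * g x| <= K.
  apply: le_trans (ler_norm_sum _ _ _) _; apply: ler_sum => x _.
  rewrite normrM ger0_norm// ler_piMl// -(mu_sum1 t) (bigD1 x)//= lerDl.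
  by apply: sumr_ge0.
exists (K + K) => a N.
suff -> : \sum_(t < N) (\sum_x mu (a + t) x * f x) - N%:R * \sum_x pi x * f x
          = \sum_x mu a x * g x - \sum_x mu (a + N)%N x * g x.
  by rewrite (le_trans (ler_normB _ _))// lerD.
elim: N => [|N IH]; first by rewrite big_ord0 mul0r addn0 !subrr.
rewrite big_ord_recr/= -natr1 mulrDl mul1r.
have E : \sum_x mu (a + N)%N x * f x - \sum_x pi x * f x
    = \sum_x mu (a + N)%N x * g x - \sum_x mu (a + N).+1 x * g x.
  under [X in _ = _ - X]eq_bigr do rewrite mu_step.
  rewrite sum_push -[RHS]sumrB -[X in _ - X]mul1r -(mu_sum1 (a + N)) mulr_suml.
  by rewrite -[LHS]sumrB; apply: eq_bigr => x _; rewrite -!mulrBr gE.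
by rewrite addnS; lra.
Qed.

End Unichain.
End Stochastic.

(** * Time to enter a set of states *)

Section Killed.
Context {R : realType} {T : finType} (P : T -> T -> R) (D : pred T).
Hypothesis P_ge0 : forall x y, 0 <= P x y.
Hypothesis P_sum1 : forall x, \sum_y P x y = 1.

(** The initial state is not tested: a start inside [D] counts as alive until a step enters [D]. *)
Fixpoint survival (j : nat) (x : T) : R :=
  if j is i.+1 then \sum_(y | ~~ D y) P x y * survival i y else 1.

Lemma survival_ge0 j x : 0 <= survival j x.
Proof.
elim: j x => //= j IH x; apply: sumr_ge0 => y _; exact: mulr_ge0.
Qed.

Lemma killed_mass_le1 x : \sum_(y | ~~ D y) P x y <= 1.
Proof. by rewrite -(P_sum1 x) [leRHS](bigID D)/= lerDr sumr_ge0. Qed.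

Lemma survival_le1 j x : survival j x <= 1.
Proof.
elim: j x => //= j IH x; apply: le_trans (killed_mass_le1 x).
by apply: ler_sum => y _; rewrite ler_piMr.
Qed.

Definition first_step (f : T -> R) :=
  forall x, f x = 1 + \sum_(y | ~~ D y) P x y * f y.

Definition partial_time (N : nat) (x : T) : R := \sum_(j < N) survival j x.

Lemma partial_timeS N x :
  partial_time N.+1 x = 1 + \sum_(y | ~~ D y) P x y * partial_time N y.
Proof.
rewrite /partial_time big_ord_recl; congr (_ + _).
under [RHS]eq_bigr do rewrite mulr_sumr.
by rewrite exchange_big.
Qed.

(** The error obeys the recursion of the killed matrix without the constant 1, so it is dominated by
    the killed iterates of the constant [\sum_y |f y|]. *)
Lemma first_step_approx (f : T -> R) : first_step f -> forall N x,
  `|f x - partial_time N x| <= (\sum_y `|f y|) * survival N x.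
Proof.
move=> fE; elim=> [|N IH] x.
  rewrite /partial_time big_ord0 subr0 mulr1 (bigD1 x)//= lerDl.
  by apply: sumr_ge0.
rewrite fE partial_timeS opprD addrACA subrr add0r -sumrB /= mulr_sumr.
apply: le_trans (ler_norm_sum _ _ _) _; apply: ler_sum => y _.
by rewrite -mulrBr normrM ger0_norm// mulrCA ler_wpM2l.
Qed.

Definition exit_time (x : T) : \bar R := (\sum_(0 <= j <oo) (survival j x)%:E)%E.

(** With [survival <= 1] the error estimate first bounds the partial sums, so the series converges
    and its terms tend to 0; the same estimate then forces the limit to be [f]. *)
Lemma exit_time_first_step (f : T -> R) :
  first_step f -> forall x, exit_time x = (f x)%:E.
Proof.
move=> fE x; set K := \sum_y `|f y|.
have K0 : 0 <= K by apply: sumr_ge0.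
have ub N : partial_time N x <= f x + K.
  have := first_step_approx fE N x; rewrite ler_norml -/K => /andP[+ _].
  have : K * survival N x <= K by rewrite ler_piMr// survival_le1.
  lra.
pose u N := partial_time N x.
have uE : u = series (survival ^~ x).
  by apply/funext => N; rewrite /series/= big_mkord.
have cu : cvgn u.
  apply: nondecreasing_is_cvgn.
    rewrite uE; apply: nondecreasing_series => ? _ _; exact: survival_ge0.
  by exists (f x + K) => _ [N _ <-]; exact: ub.
have h0 : survival j x @[j --> \oo] --> (0 : R).
  by apply: cvg_series_cvg_0; rewrite -uE.
have uf : u N @[N --> \oo] --> f x.
  have Kh : K * survival j x @[j --> \oo] --> (0 : R).
    by rewrite -(mulr0 K); apply: cvgMr.
  apply/cvgrPdist_le => e e0; near=> N.
  apply: le_trans (first_step_approx fE N x) _; rewrite -/K.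
  apply: le_trans (ler_norm _) _; rewrite -[X in `|X|]subr0.
  by near: N; move/cvgrPdist_le : Kh => /(_ e e0); under eq_near do rewrite distrC.
rewrite /exit_time; apply: cvg_lim => //.
have -> : (fun N => (\sum_(0 <= j < N) (survival j x)%:E)%E) = EFin \o u.
  by apply/funext => N; rewrite sumEFin /= /u /partial_time big_mkord.
by apply: (cvg_comp _ _ uf).
Unshelve. all: by end_near. Qed.

Lemma exit_time_ge0 x : (0 <= exit_time x)%E.
Proof. by apply: nneseries_ge0 => j _ _; rewrite lee_fin survival_ge0. Qed.

(** Exchanging sums of nonnegative terms is valid in [\bar R], so the system holds even where the
    time is infinite. *)
Lemma exit_time_system x :
  exit_time x = (1 + \sum_(y | ~~ D y) (P x y)%:E * exit_time y)%E.
Proof.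
have s0 j y : (0 <= (survival j y)%:E :> \bar R)%E by rewrite lee_fin survival_ge0.
rewrite {1}/exit_time nneseries_recl//=; congr (_ + _)%E.
rewrite -nneseries_addn//=.
transitivity (\sum_(0 <= j <oo) \sum_(y | ~~ D y) ((P x y)%:E * (survival j y)%:E))%E.
  by apply: eq_eseriesr => j _; rewrite addn1 /= -sumEFin.
rewrite nneseries_sum; last by move=> i j _; rewrite mule_ge0 ?lee_fin ?P_ge0 ?survival_ge0.
by apply: eq_bigr => y _; rewrite nneseriesZl.
Qed.

(** Bounding the killed sum by the full one covers [y] inside or outside [D]; what remains is an
    average of numbers at most 1, one of which is below 1 and has positive weight. *)
Lemma survival_lt1_step j x y :
  leads_to P x y -> survival j y < 1 -> survival j.+1 x < 1.
Proof.
rewrite /leads_to => Pxy hy /=.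
apply: le_lt_trans (_ : \sum_y P x y * survival j y < _).
  rewrite [leRHS](bigID D)/= lerDr sumr_ge0// => i _.
  by rewrite mulr_ge0// survival_ge0.
rewrite -(P_sum1 x) (bigD1 y)//= [ltRHS](bigD1 y)//= ltr_leD//.
  by rewrite gtr_pMr.
by apply: ler_sum => i _; rewrite ler_piMr// survival_le1.
Qed.

Lemma survival_lt1_connect x y : connect (leads_to P) x y ->
  (exists j, survival j y < 1) -> exists j, survival j x < 1.
Proof.
move=> /connectP[p + ->]; elim: p x => //= a p IH x /andP[xa pa].
by move=> /(IH _ pa)[j hj]; exists j.+1; exact: survival_lt1_step hj.
Qed.

(* A left null vector [v] of [1 - Q], [Q] the killed matrix, satisfies
   [sum |v| <= sum |v| survival j] for every [j], hence vanishes. *)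
Lemma first_step_exists (star : T) J :
  (forall x, connect (leads_to P) x star) -> survival J star < 1 ->
  exists f, first_step f.
Proof.
move=> to_star sJ.
have [|f fE] := @fredholm R T (fun x y => (x == y)%:R - P x y * (~~ D y)%:R) (fun=> 1).
  move=> v vM.
  have vE y : v y = (\sum_x v x * P x y) * (~~ D y)%:R.
    have := vM y; under eq_bigr do rewrite mulrBr.
    rewrite sumrB (bigD1 y)//= eqxx mulr1 big1 ?addr0; last first.
      by move=> i /negPf ->; rewrite mulr0.
    by rewrite mulr_suml => /eqP; rewrite subr_eq0 => /eqP ->; apply: eq_bigr => i _; rewrite mulrA.
  have vle j : \sum_x `|v x| <= \sum_x `|v x| * survival j x.
    elim: j => [|j IH]; first by apply: ler_sum => x _; rewrite mulr1.
    apply: le_trans IH _.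
    apply: le_trans (_ : \sum_(y | ~~ D y) (\sum_x `|v x| * P x y) * survival j y <= _).
      rewrite [leRHS]big_mkcond; apply: ler_sum => y _; rewrite {1}vE.
      case: (D y); rewrite ?mulr0 ?normr0 ?mul0r// mulr1 ler_wpM2r ?survival_ge0//.
      apply: le_trans (ler_norm_sum _ _ _) _; apply: ler_sum => x _.
      by rewrite normrM (ger0_norm (P_ge0 _ _)).
    under eq_bigr do rewrite mulr_suml.
    rewrite exchange_big /=; apply: ler_sum => x _.
    by rewrite mulr_sumr; apply: ler_sum => y _; rewrite mulrA.
  have v0 x : v x = 0.
    have [j hj] := survival_lt1_connect (to_star x) (ex_intro _ J sJ).
    have h1 y : 0 <= `|v y| * (1 - survival j y).
      by rewrite mulr_ge0// subr_ge0 survival_le1.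
    have : `|v x| * (1 - survival j x) <= 0.
      apply: le_trans (_ : \sum_y `|v y| * (1 - survival j y) <= _).
        by rewrite (bigD1 x)//= lerDl sumr_ge0.
      under eq_bigr do rewrite mulrBr mulr1.
      by rewrite sumrB subr_le0.
    by rewrite pmulr_lle0 ?subr_gt0// normr_le0 => /eqP.
  by rewrite big1// => x _; rewrite v0 mul0r.
exists f => x; have := fE x; under eq_bigr do rewrite mulrBl.
rewrite sumrB (bigD1 x)//= eqxx mul1r big1 ?addr0; last first.
  by move=> i /negPf ix; rewrite eq_sym ix mul0r.
move=> /eqP; rewrite subr_eq => /eqP ->; congr (_ + _).
rewrite [RHS]big_mkcond; apply: eq_bigr => y _.
by case: (D y); rewrite ?mulr0 ?mulr1 ?mul0r.
Qed.
End Killed.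

(** * Long-run average of the age *)

Lemma nneseries_one (R : realType) : (\sum_(0 <= j <oo) (1 : R)%:E = +oo)%E.
Proof.
apply/eqyP => A A0; apply: le_trans (nneseries_lim_ge (Num.bound A) _); last first.
  by move=> j _ _; rewrite lee_fin.
by rewrite sumEFin lee_fin sumr_const_nat subn0 ltW// archi_boundP// ltW.
Qed.

Section AgeAverage.
Context {R : realType} {T : finType} (P : T -> T -> R) (D : pred T).
Hypothesis P_ge0 : forall x y, 0 <= P x y.
Hypothesis P_sum1 : forall x, \sum_y P x y = 1.
Variable star : T.
Hypothesis to_star : forall x, connect (leads_to P) x star.
Variable pi : T -> R.
Hypothesis pi_ge0 : forall x, 0 <= pi x.
Hypothesis pi_sum1 : \sum_x pi x = 1.
Hypothesis pi_inv : invariant_vec P pi.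
Variable mu : nat -> T -> R.
Hypothesis mu_ge0 : forall t x, 0 <= mu t x.
Hypothesis mu_sum1 : forall t, \sum_x mu t x = 1.
Hypothesis mu_step : forall t y, mu t.+1 y = \sum_x mu t x * P x y.

Local Notation h := (survival P D).
Local Notation mean v f := (\sum_x v x * f x).

(* [Pr(age t > j)] is the probability that the chain, started from the law
   [mu (t - j)], makes [j] steps without entering [D]. *)
Definition mean_age (t : nat) : R := \sum_(j < t.+1) mean (mu (t - j)) (h j).

Lemma mean_survival_ge0 t j : 0 <= mean (mu t) (h j).
Proof. by apply: sumr_ge0 => x _; rewrite mulr_ge0// survival_ge0. Qed.

Lemma mean_age_ge0 t : 0 <= mean_age t.
Proof. by apply: sumr_ge0 => j _; exact: mean_survival_ge0. Qed.

(** Only the first [J] tail terms of each age are kept; for fixed [j] they form a time average to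
    which [ergodic_bound] applies from any starting time. *)
Lemma mean_age_sum_ge J : exists C, forall N,
  N%:R * mean pi (partial_time P D J) - C <= \sum_(t < N) mean_age t.+1.
Proof.
have /choice[C HC] j := ergodic_bound P_ge0 P_sum1 to_star pi_sum1 pi_inv
  mu_ge0 mu_sum1 mu_step (h j).
set s := mean pi _.
have sE : s = \sum_(j < J) mean pi (h j).
  by rewrite exchange_big; apply: eq_bigr => x _; rewrite mulr_sumr.
have s0 : 0 <= s.
  rewrite sE; apply: sumr_ge0 => j _; apply: sumr_ge0 => x _.
  by rewrite mulr_ge0// survival_ge0.
have C0 j : 0 <= C j by apply: le_trans (HC j 0 0).
(* The first [J] ages are dropped, so that each remaining one has all [J] terms; [J.+1 - j + i] is
   [(J + i).+1 - j]. *)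
have win M : \sum_(j < J) \sum_(i < M) mean (mu (J.+1 - j + i)) (h j)
    <= \sum_(t < J + M) mean_age t.+1.
  elim: M => [|M IH].
    rewrite big1 => [|j _]; last by rewrite big_ord0.
    by apply: sumr_ge0 => t _; exact: mean_age_ge0.
  rewrite addnS big_ord_recr /=; under eq_bigr do rewrite big_ord_recr /=.
  rewrite big_split /=; apply: lerD => //.
  have JM : (J <= (J + M).+2)%N by lia.
  rewrite /mean_age (big_ord_widen _ (fun j => mean (mu (J.+1 - j + M)) (h j)) JM).
  rewrite big_mkcond; apply: ler_sum => j _; case: ifPn => jJ; last exact: mean_survival_ge0.
  by rewrite (_ : (J.+1 - j + M = (J + M).+1 - j)%N)//; lia.
exists (J%:R * s + \sum_(j < J) C j) => N.
have CJ : 0 <= \sum_(j < J) C j by apply: sumr_ge0.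
have [NJ|JN] := leqP N J.
  apply: le_trans (_ : 0 <= _); last by apply: sumr_ge0 => t _; exact: mean_age_ge0.
  have : N%:R * s <= J%:R * s by rewrite ler_wpM2r// ler_nat.
  lra.
rewrite -(subnKC (ltnW JN)); apply: le_trans (win _).
set M := (N - J)%N.
apply: le_trans (_ : \sum_(j < J) (M%:R * mean pi (h j) - C j) <= _).
  rewrite sumrB -mulr_sumr -sE natrD; lra.
apply: ler_sum => j _.
by have := HC j (J.+1 - j)%N M; rewrite ler_norml => /andP[+ _]; lra.
Qed.

(* Telescoping: with [r j = f - partial_time j] and
   [W t = sum_j mu (t - j) (r j)], [mean_age t = W t - W (t+1) + mu (t+1) f]. *)
Lemma mean_age_sum_le (f : T -> R) : first_step P D f -> exists C, forall N,
  \sum_(t < N) mean_age t.+1 <= N%:R * mean pi f + C.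
Proof.
move=> fE.
have [C HC] := ergodic_bound P_ge0 P_sum1 to_star pi_sum1 pi_inv
  mu_ge0 mu_sum1 mu_step f.
pose r j x := f x - partial_time P D j x.
(* By [exit_time_first_step], [f] is the full sum of the survival probabilities, so its remainders
   are nonnegative. *)
have r0 j x : 0 <= r j x.
  rewrite subr_ge0 -lee_fin -(exit_time_first_step P_ge0 P_sum1 fE).
  apply: le_trans (nneseries_lim_ge j _); last first.
    by move=> n _ _; rewrite lee_fin survival_ge0.
  by rewrite /partial_time sumEFin big_mkord.
pose W t := \sum_(j < t.+1) mean (mu (t - j)) (r j).
have W0 t : 0 <= W t.
  by apply: sumr_ge0 => j _; apply: sumr_ge0 => x _; rewrite mulr_ge0.
have step t : mean_age t = W t - W t.+1 + mean (mu t.+1) f.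
  (* Term 0 of [W t.+1] is the mean of [f]; its term [j.+1] has the same law [mu (t - j)] as term
     [j] of [W t], and [r j - r j.+1 = h j]. *)
  rewrite {2}/W big_ord_recl subn0.
  rewrite (_ : mean _ (r 0) = mean (mu t.+1) f); last first.
    by apply: eq_bigr => x _; rewrite /r /partial_time big_ord0 subr0.
  rewrite opprD addrA addrAC subrK -sumrB; apply: eq_bigr => j _.
  rewrite subSS -sumrB; apply: eq_bigr => x _.
  by rewrite -mulrBr /r /partial_time big_ord_recr/=; congr (_ * _); ring.
exists (W 1 + C) => N.
have -> : \sum_(t < N) mean_age t.+1 =
    W 1 - W N.+1 + \sum_(t < N) mean (mu (2 + t)) f.
  elim: N => [|N IH]; first by rewrite !big_ord0 subrr addr0.
  by rewrite !big_ord_recr /= IH step add2n; ring.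
have := HC 2 N; rewrite ler_norml => /andP[_].
have := W0 N.+1; lra.
Qed.

Lemma partial_time_cvg :
  (mean pi (partial_time P D J))%:E @[J --> \oo]
  --> (\sum_x exit_time P D x * (pi x)%:E)%E.
Proof.
pose u j := (mean pi (h j))%:E : \bar R.
have u0 j : (0 <= u j)%E.
  by rewrite lee_fin; apply: sumr_ge0 => x _; rewrite mulr_ge0// survival_ge0.
have -> : (\sum_x exit_time P D x * (pi x)%:E)%E = (\sum_(0 <= j <oo) u j)%E.
  under [RHS]eq_eseriesr do rewrite /u -sumEFin.
  rewrite nneseries_sum; last first.
    by move=> i j _; rewrite lee_fin mulr_ge0// survival_ge0.
  apply: eq_bigr => x _; rewrite muleC -nneseriesZl//.
  by move=> j _; rewrite lee_fin survival_ge0.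
have -> : (fun J => (mean pi (partial_time P D J))%:E) =
    (fun J => (\sum_(0 <= j < J) u j)%E).
  apply/funext => J; rewrite sumEFin big_mkord exchange_big; congr (_%:E).
  by apply: eq_bigr => x _; rewrite mulr_sumr.
by apply: is_cvg_nneseries => j _ _.
Qed.

(** The alternative is decided at [star]: if survival from there is certain for every [j], the exit
    time is infinite at a state of positive stationary mass. *)
Lemma first_step_or_infinite :
  (exists f, first_step P D f) \/ (\sum_x exit_time P D x * (pi x)%:E = +oo)%E.
Proof.
have [[J hJ]|no] := pselect (exists J, h J star < 1).
  by left; exact: first_step_exists to_star hJ.
right; have h1 j : h j star = 1.
  apply/eqP; rewrite eq_le survival_le1//= leNgt; apply/negP => hj.
  by apply: no; exists j.
have infty : exit_time P D star = +oo%E.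
  by rewrite /exit_time; under eq_eseriesr do rewrite h1; exact: nneseries_one.
rewrite (bigD1 star)//= infty gt0_mulye; last first.
  by rewrite lte_fin; exact: stationary_star_gt0 pi_inv.
rewrite addye// gt_eqF// (lt_le_trans ltNy0)// sume_ge0// => x _.
by rewrite mule_ge0 ?lee_fin// exit_time_ge0.
Qed.

Lemma mean_age_cvg :
  (N%:R^-1 * \sum_(t < N) mean_age t.+1)%:E @[N --> \oo]
  --> (\sum_x exit_time P D x * (pi x)%:E)%E.
Proof.
pose a (N : nat) : R := N%:R^-1 * \sum_(t < N) mean_age t.+1.
rewrite -[X in X @ _ --> _]/(fun N => (a N)%:E).
have low J : exists C, \forall N \near \oo, mean pi (partial_time P D J) - C / N%:R <= a N.
  have [C HC] := mean_age_sum_ge J; exists C; near=> N.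
  have N0 : 0 < N%:R :> R by rewrite ltr0n; near: N; exact: nbhs_infty_gt.
  by rewrite /a [leRHS]mulrC ler_pdivlMr// mulrBl divfK ?gt_eqF// mulrC.
have div0 (C : R) : C / N%:R @[N --> \oo] --> (0 : R).
  rewrite -(mulr0 C); apply: cvgMr; apply/gtr0_cvgV0; last exact: cvgr_idn.
  by near=> N; rewrite ltr0n; near: N; exact: nbhs_infty_gt.
have low' J e : 0 < e -> \forall N \near \oo, mean pi (partial_time P D J) - e <= a N.
  move=> e0; have [C HC] := low J.
  near=> N; apply: le_trans (_ : mean pi (partial_time P D J) - C / N%:R <= _); last by near: N.
  rewrite lerB//; apply: le_trans (ler_norm _) _; rewrite -[X in `|X|]subr0.
  by near: N; move/cvgrPdist_le : (div0 C) => /(_ e e0); under eq_near do rewrite distrC.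
have := partial_time_cvg.
have [[f fE]|->] := first_step_or_infinite; last first.
  (* Infinite limit: the lower bound suffices, with [J] chosen to exceed [A + 1] and an error of
     1. *)
  move=> /cvgeyPge sy; apply/cvgeyPge => A.
  have [J _ /(_ J (leqnn J))] := sy (A + 1); rewrite lee_fin => AJ.
  near=> N; rewrite lee_fin.
  apply: le_trans (_ : mean pi (partial_time P D J) - 1 <= _); first by rewrite lerBrDr.
  by near: N; exact: low'.
(* Finite limit: the exit time is the real solution [f], and [mean_age_sum_le] supplies the upper
   bound. *)
under eq_bigr do rewrite (exit_time_first_step P_ge0 P_sum1 fE) -EFinM mulrC.
rewrite sumEFin => /fine_cvgP[_ /cvgrPdist_le sr].
apply: cvg_EFin; first exact: nearW.
apply/cvgrPdist_le => e e0.
have [C HC] := mean_age_sum_le fE.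
have e2 : 0 < e / 2 by rewrite divr_gt0.
have [J _ /(_ J (leqnn J))/=] := sr _ e2; rewrite ler_norml => /andP[_ sJ].
near=> N.
rewrite ler_norml; apply/andP; split; last first.
  have : mean pi (partial_time P D J) - e / 2 <= a N by near: N; exact: low'.
  by move=> /=; lra.
have N0 : 0 < N%:R :> R by rewrite ltr0n; near: N; exact: nbhs_infty_gt.
have : a N <= mean pi f + C / N%:R.
  by rewrite /a [leLHS]mulrC ler_pdivrMr// mulrDl divfK ?gt_eqF// mulrC.
have : C / N%:R <= e.
  apply: le_trans (ler_norm _) _; rewrite -[X in `|X|]subr0.
  by near: N; move/cvgrPdist_le : (div0 C) => /(_ e e0); under eq_near do rewrite distrC.
by rewrite /=; lra.
Unshelve. all: by end_near. Qed.
End AgeAverage.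

(** * The truncated chain *)

Lemma sum2E (V : nmodType) (F : 'I_2 -> V) : \sum_i F i = F one + F two.
Proof. by rewrite !big_ord_recl big_ord0 addr0; congr (_ + F _); exact: val_inj. Qed.

Lemma prod2E (V : comPzSemiRingType) (F : 'I_2 -> V) :
  \prod_i F i = F one * F two.
Proof. by rewrite !big_ord_recl big_ord0 mulr1; congr (_ * F _); exact: val_inj. Qed.

Lemma ord2_cases (P : 'I_2 -> Prop) : P one -> P two -> forall k, P k.
Proof.
move=> P1 P2 [[|[|//]] lt]; first by rewrite (_ : Ordinal lt = one)//; exact: val_inj.
by rewrite (_ : Ordinal lt = two)//; exact: val_inj.
Qed.

Section Chain.
Context {R : realType} (p : nsr_policy R) (B Rmax : R).
Hypothesis hp : valid_policy p B Rmax.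
Variable n : 'I_2.
Local Notation z := (thr p).
Local Notation St := (state (thr p)).

Lemma sage_gt0 (phi : St) k : (0 < sage phi k)%N. Proof. by []. Qed.
Lemma sage_le (phi : St) k : (sage phi k <= z)%N. Proof. exact: ltn_ord. Qed.

Lemma state_ext (phi phi' : St) : sage phi =1 sage phi' -> phi = phi'.
Proof. by move=> e; apply/ffunP => k; apply: val_inj; have [] := e k. Qed.

Lemma state_of_ages (a : 'I_2 -> nat) :
  (forall k, (0 < a k <= z)%N) -> exists phi : St, forall k, sage phi k = a k.
Proof.
move=> ha; have lt k : ((a k).-1 < z)%N by have := ha k; lia.
exists [ffun k => Ordinal (lt k)] => k.
by rewrite /sage ffunE /= prednK//; have /andP[] := ha k.
Qed.

Definition serve (phi : St) (k : 'I_2) : R :=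
  serve_prob p k (sage phi one) (sage phi two).

Definition rate (phi : St) (k : 'I_2) : R := serve phi k * zeta p n k.

Definition grown (phi : St) (k : 'I_2) : nat := minn (sage phi k).+1 z.

(** Distinct capped ages leave the smaller one below [z], so the threshold tests of the policy hold
    by themselves. On the diagonal the tie rule decides both the branch of the policy and the
    region, and at [(z, z)] both give [r/2]. *)
Lemma serve_region phi :
  (serve phi one = by_region phi (cmd_total p / 2) (cmdp p one) (cmdp p two)) *
  (serve phi two = by_region phi (cmd_total p / 2) (cmdp p two) (cmdp p one)).
Proof.
have := sage_le phi one; have := sage_le phi two.
rewrite /serve /serve_prob /by_region !inE /cmd_total.
move: (sage phi one) (sage phi two) => a b hb ha.
have [ab|ba|->] := ltngtP a b.
- by rewrite andbF (leq_trans ab hb)/=; rewrite ?andbF; split; ring.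
- by rewrite andbF (leq_trans ba ha).
- by rewrite andbT; case: (is_even _).
Qed.

Lemma zetabarE k : zetabar p n k = 1 - zeta p n k.
Proof. by rewrite /zeta opprB addrC subrK. Qed.

Lemma grown_ge2 phi k : (2 <= grown phi k)%N.
Proof. by rewrite /grown leq_min (thr_ge2 hp) ltnS sage_gt0. Qed.

(** Given [phi], the two ages move independently. A grown age is at least 2, so a reset and a growth
    are never confused and the four cases are the terms of the product. *)
Lemma trans_prod phi phi' : trans (p := p) n phi phi' =
  \prod_k (rate phi k * (sage phi' k == 1%N)%:R +
           (1 - rate phi k) * (sage phi' k == grown phi k)%:R).
Proof.
rewrite prod2E /trans !xpair_eqE -/(grown phi one) -/(grown phi two).
have h1 := grown_ge2 phi one; have h2 := grown_ge2 phi two.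
have H k : (sage phi' k == 1%N) && (sage phi' k == grown phi k) = false.
  by apply/negP => /andP[/eqP-> /eqP e]; have := grown_ge2 phi k; rewrite -e.
have := H one; have := H two.
rewrite !zetabarE /rate !serve_region /by_region.
case: (_ == 1%N); case: (_ == 1%N); case: (_ == grown _ _); case: (_ == grown _ _) => //= _ _;
  (case: ifP => _; last case: ifP => _); ring.
Qed.

Lemma serve_itv phi k : 0 <= serve phi k <= 1.
Proof.
have := cmdp_itv hp one; have := cmdp_itv hp two.
move: k; apply: ord2_cases; rewrite serve_region /by_region /cmd_total;
  (case: ifP => _; last case: ifP => _); lra.
Qed.

Lemma zeta_itv k : 0 <= zeta p n k <= 1.
Proof. by have := reqp_itv hp k n; rewrite /zeta /zetabar; nra. Qed.

Lemma rate_itv phi k : 0 <= rate phi k <= 1.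
Proof.
by have := serve_itv phi k; have := zeta_itv k; rewrite /rate; nra.
Qed.

Lemma trans_ge0 phi phi' : 0 <= trans (p := p) n phi phi'.
Proof.
rewrite trans_prod; apply: prodr_ge0 => k _.
by have /andP[r0 r1] := rate_itv phi k; rewrite addr_ge0// mulr_ge0// subr_ge0.
Qed.

Lemma trans_sum1 phi : \sum_(phi' : St) trans (p := p) n phi phi' = 1.
Proof.
under eq_bigr do rewrite trans_prod.
pose F k (i : 'I_z) := rate phi k * (i.+1 == 1%N)%:R +
           (1 - rate phi k) * (i.+1 == grown phi k)%:R.
rewrite -(bigA_distr_bigA F) big1// => k _.
have sum1 a : (0 < a <= z)%N -> \sum_(i < z) (i.+1 == a)%:R = 1 :> R.
  case: a => // a /= az; rewrite (bigD1 (Ordinal az))//= eqxx big1 ?addr0// => i.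
  by rewrite -val_eqE /= eqSS => /negPf ->.
rewrite big_split /= -!mulr_sumr !sum1; first by ring.
  by rewrite geq_minr andbT (leq_trans _ (grown_ge2 phi k)).
by rewrite /= (leq_trans _ (thr_ge2 hp)).
Qed.

(** [u] prescribes which CPs are heard. By the product form, an outcome is possible as soon as each
    coordinate allows it; the paths to the reachable state are built from such steps. *)
Lemma trans_step phi (u : 'I_2 -> bool) :
  (forall k, if u k then 0 < rate phi k else rate phi k < 1) ->
  exists phi', leads_to (@trans R p n) phi phi' /\
    forall k, sage phi' k = if u k then 1%N else grown phi k.
Proof.
move=> hu; have [k|phi' e] := @state_of_ages (fun k => if u k then 1%N else grown phi k).
  case: ifP => _; first by rewrite /= (leq_trans _ (thr_ge2 hp)).
  by rewrite geq_minr andbT (leq_trans _ (grown_ge2 phi k)).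
exists phi'; split=> //; rewrite /leads_to trans_prod prodr_gt0// => k _.
have := hu k; have := rate_itv phi k; rewrite e; case: (u k) => /andP[r0 r1] h.
  by rewrite eqxx mulr1 ltr_wpDr// mulr_ge0// subr_ge0.
  by rewrite eqxx mulr1 ltr_wpDl ?subr_gt0// (mulr_ge0 r0).
Qed.

End Chain.

(** * Reachability in the truncated chain *)

Section Star.
Context {R : realType} (p : nsr_policy R) (B Rmax : R).
Hypothesis hp : valid_policy p B Rmax.
Variable n : 'I_2.
Local Notation z := (thr p).
Local Notation St := (state (thr p)).
Local Notation leads := (leads_to (trans (p := p) n)).

Lemma connect_measure (T : finType) (e : rel T) (m : T -> nat) (y : T) :
  (forall x, x <> y -> exists x', e x x' /\ (m x' < m x)%N) ->
  forall x, connect e x y.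
Proof.
move=> dec x; have [k] := ubnP (m x); elim: k => // k IH in x *; rewrite ltnS => mx.
have [->//|/eqP xy] := eqVneq x y.
have [x' [xx' lt]] := dec x xy.
exact: connect_trans (connect1 xx') (IH _ (leq_trans lt mx)).
Qed.

Lemma connect_step (phi star : St) (u : 'I_2 -> bool) :
  (forall k, if u k then 0 < rate n phi k else rate n phi k < 1) ->
  (forall phi', (forall k, sage phi' k = if u k then 1%N else grown phi k) ->
     connect leads phi' star) ->
  connect leads phi star.
Proof.
move=> hu H; have [phi' [l e]] := trans_step hp hu.
exact: connect_trans (connect1 l) (H _ e).
Qed.

Lemma star_all_served : (forall (phi : St) k, 0 < rate n phi k) ->
  exists star, forall phi, connect leads phi star.
Proof.
move=> pos; have [k|star es] := @state_of_ages _ p (fun=> 1%N).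
  by rewrite /= (leq_trans _ (thr_ge2 hp)).
exists star => phi; apply: (@connect_step _ _ xpredT) => [k|phi' e]; first exact: pos.
by rewrite (_ : phi' = star)//; apply: state_ext => k; rewrite e es.
Qed.

(* If CP [k] is never heard, [g_k] climbs to [z]; then either the other CP is
   always heard, or both ages can climb to [z]. *)
Lemma star_dead (k k' : 'I_2) : k != k' -> (forall phi : St, rate n phi k = 0) ->
  (forall phi : St, rate n phi k' = 1) \/
  (forall phi : St, sage phi k = z -> (sage phi k' < z)%N -> rate n phi k' < 1) ->
  exists star, forall phi, connect leads phi star.
Proof.
move=> kk' dead alt; have z2 := thr_ge2 hp.
have k'k : (k' == k) = false by rewrite eq_sym (negPf kk').
have twoP (P : 'I_2 -> Prop) : P k -> P k' -> forall i, P i.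
  move: kk'; clear; elim/ord2_cases: k; elim/ord2_cases: k' => // _ Pk Pk'; exact: ord2_cases.
have sz phi i : (sage phi i <= z)%N := sage_le phi i.
have [full|part] := alt.
  have [i|star es] := @state_of_ages _ p (fun i => if i == k then z else 1%N).
    by case: ifP => _; lia.
  exists star.
  apply: (@connect_measure _ _
    (fun phi => z - sage phi k + (sage phi k' != 1))%N) => phi ne.
  have [|phi' [l e]] := @trans_step _ p _ _ hp n phi (fun i => i != k).
    apply: (twoP); first by rewrite eqxx /= dead ltr01.
    by rewrite k'k full ltr01.
  exists phi'; split => //; rewrite !e eqxx k'k /= addn0 /grown.
  have := sz phi k; have := sage_gt0 phi k.
  have [ek|] := eqVneq (sage phi k) z; last by lia.
  have [ek'|] := eqVneq (sage phi k') 1%N; last by rewrite ek; lia.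
  by case: ne; apply: state_ext; apply: (twoP); rewrite es ?eqxx ?k'k.
have [i|star es] := @state_of_ages _ p (fun=> z); first by lia.
(* Lexicographic measure: the weight [z.+1] lets one unit gained by [g_k] outweigh any loss on
   [g_k']. *)
exists star; apply: (@connect_measure _ _
  (fun phi => (z - sage phi k) * z.+1 + (z - sage phi k'))%N) => phi ne.
(* While [g_k < z], CP [k'] is heard whenever that is possible; at [g_k = z] both ages are left to
   grow, which [part] permits. *)
have [|phi' [l e]] := @trans_step _ p _ _ hp n phi
    (fun i => (i != k) && (sage phi k < z)%N && (0 < rate n phi i)).
  apply: (twoP); first by rewrite eqxx /= dead.
  rewrite k'k /=; case: ifP; first by case/andP.
  have [kz|kz] := ltnP (sage phi k) z; first by move/negbT; rewrite -leNgt => /le_lt_trans ->.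
  move=> _; have ek : sage phi k = z by apply/eqP; rewrite eqn_leq sz.
  apply: part => //; rewrite ltn_neqAle sz andbT; apply/eqP => ek'.
  by case: ne; apply: state_ext; apply: (twoP); rewrite es.
exists phi'; split => //; rewrite !e eqxx k'k /= /grown.
have := sz phi k; have := sage_gt0 phi k; have := sz phi k'; have := sage_gt0 phi k'.
move: ne e; case: (ltnP (sage phi k) z) => kz ne e h1 h2 h3 h4 /=.
  have : (z - minn (sage phi k).+1 z).+1 = (z - sage phi k)%N by lia.
  by move=> <-; rewrite mulSn; case: ifP => _; lia.
have ek : sage phi k = z by lia.
have ek' : sage phi k' <> z.
  by move=> ek'; case: ne; apply: state_ext; apply: (twoP); rewrite es.
rewrite ek; lia.
Qed.

Lemma serve_le (phi : St) k : serve phi k <= cmdp p one.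
Proof.
have := cmdp_itv hp two; have := cmdp_le hp.
move: k; apply: ord2_cases; rewrite serve_region /by_region /cmd_total;
  (case: ifP => _; last case: ifP => _); lra.
Qed.

Lemma serve_ge (phi : St) k : cmdp p two <= serve phi k.
Proof.
have := cmdp_le hp.
move: k; apply: ord2_cases; rewrite serve_region /by_region /cmd_total;
  (case: ifP => _; last case: ifP => _); lra.
Qed.

Lemma serve_stale (phi : St) k k' : k != k' ->
  sage phi k = z -> (sage phi k' < z)%N -> serve phi k' = cmdp p two.
Proof.
elim/ord2_cases: k; elim/ord2_cases: k' => // _ e lt; rewrite serve_region /by_region !inE e.
  by rewrite lt.
have -> : (z < sage phi one)%N = false by lia.
by rewrite lt; case: ifP => //; lia.
Qed.

(** CP [k'] is served with at least [r_2]. If [r_2] times its [zeta] reaches 1, it is always heard;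
    otherwise it can be missed once [g_k = z], because the fresher CP is served with exactly
    [r_2]. *)
Lemma star_dead_cp (k k' : 'I_2) : k != k' -> (forall phi : St, rate n phi k = 0) ->
  exists star, forall phi, connect leads phi star.
Proof.
move=> kk' dead; apply: (star_dead kk' dead).
have zk := zeta_itv hp n k'; have c2 := cmdp_itv hp two.
have [lt|ge] := ltP (cmdp p two * zeta p n k') 1.
  by right => phi e e'; rewrite /rate (serve_stale kk').
left=> phi; apply/eqP; rewrite eq_le; have /andP[_ ->] := rate_itv hp n phi k'.
by apply: le_trans ge _; rewrite /rate ler_wpM2r ?serve_ge//; case/andP: zk.
Qed.

(** Off the diagonal only the staler CP is served. Hearing the CPs alternately leads through a state
    of region 2 with [g_1 = 1] to [(2, 1)]. *)
Lemma star_alternating : cmdp p two = 0 -> 0 < cmdp p one ->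
  (forall k, 0 < zeta p n k) -> exists star, forall phi, connect leads phi star.
Proof.
move=> r2 r1 zpos; have z2 := thr_ge2 hp.
have [k|star es] := @state_of_ages _ p (fun k => if k == one then 2 else 1%N).
  by case: ifP => _; lia.
have r1le : cmdp p one <= 1 by have := cmdp_itv hp one; lra.
have zle k : zeta p n k <= 1 by have := zeta_itv hp n k; lra.
have from2 phi : phi \in region2 p -> phi \notin region1 p ->
    sage phi one = 1%N -> connect leads phi star.
  move=> h2 h1 e1; apply: (@connect_step _ _ (fun k => k == two)).
    apply: ord2_cases; rewrite /= /rate serve_region /by_region (negPf h1) h2.
      by rewrite r2 mul0r.
    by rewrite mulr_gt0.
  move=> phi' e'; rewrite (_ : phi' = star)//; apply: state_ext.
  by apply: ord2_cases; rewrite e' es//= /grown e1; lia.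
have region_excl phi : phi \in region2 p -> phi \notin region1 p.
  by rewrite !inE; lia.
have from13 phi : phi \notin region2 p -> connect leads phi star.
  move=> h2; apply: (@connect_step _ _ (fun k => k == one)).
    apply: ord2_cases; rewrite /= /rate serve_region /by_region (negPf h2).
      by case: ifP => _; rewrite mulr_gt0// /cmd_total r2; lra.
    (* In region 3 CP 2 is served with probability [r_1 / 2], at most 1/2, so it can be missed. *)
    have := zpos two; have := zle two; rewrite /cmd_total r2; case: ifP => _; nra.
  move=> phi' e'; have h : phi' \in region2 p.
    by rewrite inE !e' /= /grown; have := sage_gt0 phi two; lia.
  by apply: (from2 phi' h (region_excl _ h)); rewrite e'.
exists star => phi; have [h2|] := boolP (phi \in region2 p); last exact: from13.
apply: (@connect_step _ _ (fun k => k == two)).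
  apply: ord2_cases; rewrite /= /rate serve_region /by_region (negPf (region_excl _ h2)) h2.
    by rewrite r2 mul0r.
  by rewrite mulr_gt0.
move=> phi' e'; apply: from13.
by rewrite inE !e' /= /grown -leqNgt; lia.
Qed.

(** Cases: a CP never requested at [n] ([zeta = 0]); otherwise [r_2 > 0]; otherwise [r_2 = 0 < r_1];
    and finally no command at all, where CP 1 counts as dead. *)
Lemma star_exists : exists star, forall phi, connect leads phi star.
Proof.
have [z0|/forallNP zpos] := pselect (exists k, zeta p n k = 0).
  case: z0 => k zk; have [k' kk'] : exists k', k != k'.
    by move: k {zk}; apply: ord2_cases; [exists two|exists one].
  by apply: (star_dead_cp kk') => phi; rewrite /rate zk mulr0.
have {}zpos k : 0 < zeta p n k.
  rewrite lt_neqAle; have /andP[-> _] := zeta_itv hp n k; rewrite andbT.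
  by apply/eqP => e; apply: (zpos k).
have [r2|] := ltP 0 (cmdp p two).
  by apply: star_all_served => phi k; rewrite mulr_gt0// (lt_le_trans r2)// serve_ge.
have /andP[+ _] := cmdp_itv hp two => r2 r2'.
have {r2 r2'} r2 : cmdp p two = 0 by apply/eqP; rewrite eq_le r2 r2'.
have [r1|r1] := ltP 0 (cmdp p one); first exact: star_alternating.
apply: (@star_dead_cp one two) => // phi; rewrite /rate.
suff -> : serve phi one = 0 by rewrite mul0r.
by apply/eqP; rewrite eq_le (le_trans (serve_le _ _) r1) -r2 serve_ge.
Qed.

Lemma no_recv_prob_survival k j (phi : St) :
  no_recv_prob n k j phi = survival (trans (p := p) n) (fun y => y \in down z k) j phi.
Proof.
elim: j phi => [|j IH] phi /=.
  rewrite /no_recv_prob (big_pred1 [tuple])//.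
  by move=> s; rewrite tuple0 /= eqxx.
rewrite /no_recv_prob.
rewrite (reindex (fun ys : St * j.-tuple St => cons_tuple ys.1 ys.2)) /=; last first.
  exists (fun s => (thead s, behead_tuple s)) => [[y s] _|s _] /=.
    by congr pair; exact: val_inj.
  by apply: val_inj; rewrite [RHS](congr1 val (tuple_eta s)).
rewrite -(pair_big_dep (fun y => y \notin down z k)
  (fun (_ : St) (s : j.-tuple St) => all (fun x => x \notin down z k) s)
  (fun y (s : j.-tuple St) => trans n phi y * path_prob n y s)) /=.
by apply: eq_bigr => y _; rewrite -mulr_sumr -IH.
Qed.

End Star.

(** * Slots and histories *)

Section FiniteObservables.
Context {d : measure_display} {Omega : measurableType d}.

(** Measurability by fibers, so that the target needs no sigma-algebra. *)
Definition fin_measurable (I : Type) (X : Omega -> I) :=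
  forall i, measurable [set w | X w = i].

Lemma fin_measurable_preimage (I : finType) (X : Omega -> I) (Q : I -> Prop) :
  fin_measurable X -> measurable [set w | Q (X w)].
Proof.
move=> mX; rewrite (_ : [set _ | _] = \bigcup_(i in [set i | Q i]) [set w | X w = i]).
  by apply: fin_bigcup_measurable => //; exact: finite_finset.
by apply/seteqP; split=> [w Qw|w [i Qi /= e]]; [by exists (X w)|by rewrite /= e].
Qed.

Lemma fin_measurable_pair (I J : Type) (X : Omega -> I) (Y : Omega -> J) :
  fin_measurable X -> fin_measurable Y -> fin_measurable (fun w => (X w, Y w)).
Proof.
move=> mX mY [i j]; rewrite (_ : [set _ | _] = [set w | X w = i] `&` [set w | Y w = j]).
  exact: measurableI.
by apply/seteqP; split=> [w /= [<- <-]//|w [/= <- <-]//].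
Qed.

Lemma fin_measurable_ffun (I : finType) (J : Type) (X : I -> Omega -> J) :
  (forall i, fin_measurable (X i)) -> fin_measurable (fun w => [ffun i => X i w]).
Proof.
move=> mX f; rewrite (_ : [set _ | _] = \bigcap_(i in [set: I]) [set w | X i w = f i]).
  by apply: fin_bigcap_measurable => [|i _]; [exact: finite_finset|exact: mX].
apply/seteqP; split=> [w <- i _ /=|w H /=]; first by rewrite ffunE.
by apply/ffunP => i; rewrite ffunE; exact: H.
Qed.

Lemma fin_measurable_bool (b : Omega -> bool) :
  measurable [set w | b w] -> fin_measurable b.
Proof.
move=> mb [] //; rewrite (_ : [set _ | _] = ~` [set w | b w]); first exact: measurableC.
by apply/seteqP; split=> w /=; [move=> ->|move/negP/negbTE].
Qed.

Lemma measure_split (R : realType) (mu : probability Omega R)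
    (I : finType) (X : Omega -> I) (A : set Omega) :
  fin_measurable X -> measurable A ->
  mu A = (\sum_i mu (A `&` [set w | X w = i]))%E.
Proof.
move=> mX mA.
rewrite {1}(_ : A = \bigcup_(i in [set: I]) (A `&` [set w | X w = i])); last first.
  by apply/seteqP; split=> [w Aw|w [i _ []]//]; exists (X w).
rewrite measure_fin_bigcup//.
- rewrite (_ : [set: I] = [set` index_enum I]) -?fsbig_seq ?index_enum_uniq//.
  by apply/seteqP; split=> i _ //=; exact: mem_index_enum.
- exact: finite_finset.
- by move=> i j _ _ [w [[_ /= <-] [_ /= <-]]].
- by move=> i _; apply: measurableI => //; exact: mX.
Qed.

End FiniteObservables.

Lemma sum_pairE (V : nmodType) (A B : finType) (F : A * B -> V) :
  \sum_x F x = \sum_a \sum_b F (a, b).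
Proof. by rewrite pair_bigA; apply: eq_bigr => -[]. Qed.

Lemma sum_boolE (V : nmodType) (F : bool -> V) : \sum_b F b = F true + F false.
Proof. exact: big_bool. Qed.

Definition pick2 (T : Type) (x : T * T) (i : 'I_2) : T :=
  if i == one then x.1 else x.2.

Section Slot.
Context {R : realType} (p : nsr_policy R) (B Rmax : R).
Hypothesis hp : valid_policy p B Rmax.
Local Notation z := (thr p).

(** This is why the truncated ages form a chain: capping alters a comparison only when both ages
    reach [z], and there the rule yields [r/2] in any case. *)
Lemma serve_min k (g1 g2 : nat) :
  serve_prob p k (minn g1 z) (minn g2 z) = serve_prob p k g1 g2.
Proof.
rewrite /serve_prob; case: (is_even _) => /=;
by repeat (case: ifP => //=); lia.
Qed.

(* What concerns one CP in one slot: the requests of the two CUs to the two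
   eRRHs, then the commands of the two eRRHs. *)
Definition cp_slot : finType := ((bool * bool) * (bool * bool) * (bool * bool))%type.

Definition cp_weight (k : 'I_2) (s : 'I_2 -> R) (x : cp_slot) : R :=
  (\prod_(m < 2) request_law p k (pick2 (pick2 x.1 m))) *
  (\prod_(n < 2) bernoulli_law (s n) (pick2 x.2 n)).

Definition received (n : 'I_2) (x : cp_slot) : bool :=
  pick2 x.2 n && (pick2 x.1.1 n || pick2 x.1.2 n).

(** The 64 outcomes of the slot reduce to heard or not heard; the square in [zeta] comes from the
    two CUs. The test function [F] later becomes the indicator of a target age. *)
Lemma cp_weight_received n k (s : 'I_2 -> R) (F : bool -> R) :
  \sum_x cp_weight k s x * F (received n x) =
  s n * zeta p n k * F true + (1 - s n * zeta p n k) * F false.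
Proof.
rewrite !(sum_pairE, sum_boolE) /cp_weight /received.
rewrite !prod2E /request_law /bernoulli_law /zeta /zetabar /pick2.
have [-> ->] : (one == one = true) /\ (two == one = false) by [].
by elim/ord2_cases: n => /=; ring.
Qed.
End Slot.

Lemma age_ext (b b' : requests) (c c' : commands) n k t :
  (forall s, (s < t)%N -> (forall m k n, b s m k n = b' s m k n) /\
                          (forall n k, c s n k = c' s n k)) ->
  age b c n k t = age b' c' n k t.
Proof.
elim: t => //= t IH H; have [hb hc] := H t (ltnSn t).
rewrite hc IH => [|s st]; last by apply: H; exact: ltnW.
by under eq_bigr do rewrite hb.
Qed.

Definition slot : finType := {ffun 'I_2 -> cp_slot}.

Definition slot_request (c : slot) (m k n : 'I_2) : bool := pick2 (pick2 (c k).1 m) n.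
Definition slot_command (c : slot) (n k : 'I_2) : bool := pick2 (c k).2 n.

Definition history (t : nat) : finType := {ffun 'I_t -> slot}.

Definition history_slot t (h : history t) (s : nat) : slot :=
  if insub s is Some i then h i else [ffun=> ((false, false), (false, false), (false, false))].

Definition history_requests t (h : history t) : requests :=
  fun s => slot_request (history_slot h s).
Definition history_commands t (h : history t) : commands :=
  fun s => slot_command (history_slot h s).

Lemma history_slotE t (h : history t) s (st : (s < t)%N) :
  history_slot h s = h (Ordinal st).
Proof. by rewrite /history_slot insubT. Qed.

(** * Markov property of the truncated ages *)

Section Process.
Context {R : realType} (p : nsr_policy R) (B Rmax : R).
Hypothesis hp : valid_policy p B Rmax.
Context {d : measure_display} {Omega : measurableType d} (Pr : probability Omega R).
Context (beta : Omega -> requests) (gamma : Omega -> commands).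
Hypothesis hproc : nsr_process p Pr beta gamma.
Local Notation z := (thr p).
Local Notation St := (state (thr p)).
Local Notation AoI := (AoI beta gamma).

Definition observed (t : nat) (w : Omega) : slot := [ffun k =>
  ((beta w t one k one, beta w t one k two),
   (beta w t two k one, beta w t two k two),
   (gamma w t one k, gamma w t two k))].

Lemma observed_request t w m k n : slot_request (observed t w) m k n = beta w t m k n.
Proof. by rewrite /slot_request ffunE; elim/ord2_cases: m; elim/ord2_cases: n. Qed.

Lemma observed_command t w n k : slot_command (observed t w) n k = gamma w t n k.
Proof. by rewrite /slot_command ffunE; elim/ord2_cases: n. Qed.

Lemma observed_eq t w (c : slot) : observed t w = c <->
  (forall m k n, beta w t m k n = slot_request c m k n) /\
  (forall n k, gamma w t n k = slot_command c n k).
Proof.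
split=> [<-|[hb hc]].
  by split=> *; rewrite ?observed_request ?observed_command.
apply/ffunP => k; rewrite ffunE !hb !hc /slot_request /slot_command /=.
by case: (c k) => [[[? ?] [? ?]] [? ?]].
Qed.

Definition observed_history (t : nat) (w : Omega) : history t :=
  [ffun i : 'I_t => observed i w].

Lemma fin_measurable_observed t : fin_measurable (observed t).
Proof.
have mb m k n := fin_measurable_bool (beta_meas hproc t m k n).
have mg n k := fin_measurable_bool (gamma_meas hproc t n k).
by apply: fin_measurable_ffun => k; do !apply: fin_measurable_pair.
Qed.

Lemma fin_measurable_history t : fin_measurable (observed_history t).
Proof. by apply: fin_measurable_ffun => i; exact: fin_measurable_observed. Qed.

Lemma history_past t (h : history t) :
  past beta gamma t (history_requests h) (history_commands h)
  = [set w | observed_history t w = h].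
Proof.
apply/seteqP; split=> w /= H.
  apply/ffunP => i; rewrite ffunE; apply/observed_eq.
  have [hb hc] := H i (ltn_ord i).
  rewrite /history_requests /history_commands (history_slotE _ (ltn_ord i)) in hb hc.
  by rewrite (_ : Ordinal _ = i) in hb hc; last exact: val_inj.
move=> s st; rewrite /history_requests /history_commands (history_slotE _ st).
by apply/observed_eq; rewrite -H ffunE.
Qed.

Lemma AoI_history t n k w : AoI n k t w =
  age (history_requests (observed_history t w)) (history_commands (observed_history t w)) n k t.
Proof.
apply: age_ext => s st.
rewrite /history_requests /history_commands (history_slotE _ st) ffunE /=.
by split=> *; rewrite ?observed_request ?observed_command.
Qed.

Lemma slot_product t (h : history t) (c : slot) :
  Pr ([set w | observed_history t w = h] `&` [set w | observed t w = c]) =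
  (Pr [set w | observed_history t w = h] *
   (\prod_k cp_weight p k (fun n => serve_prob p k
      (age (history_requests h) (history_commands h) n one t)
      (age (history_requests h) (history_commands h) n two t)) (c k))%:E)%E.
Proof.
(* [slot_law] is stated for entire paths, so [h] before [t] is spliced with [c] from [t] on. *)
pose x : requests := fun s => if (s < t)%N then history_requests h s else slot_request c.
pose y : commands := fun s => if (s < t)%N then history_commands h s else slot_command c.
have xy_lt s : (s < t)%N -> (forall m k n, x s m k n = history_requests h s m k n) /\
    (forall n k, y s n k = history_commands h s n k).
  by move=> st; rewrite /x /y st.
have pastE : past beta gamma t x y = [set w | observed_history t w = h].
  rewrite -history_past; apply/seteqP; split=> w H s st;
    have [e e'] := xy_lt s st; have [hb hc] := H s st.
    by split=> *; rewrite -?e -?e'.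
  by split=> *; rewrite ?e ?e'.
have presE : present beta gamma t x y = [set w | observed t w = c].
  apply/seteqP; split=> w; rewrite /present /x /y ltnn /=; first by move/observed_eq.
  by move/observed_eq.
rewrite -presE -pastE (slot_law hproc); congr (_ * _%:E)%E.
rewrite !prod2E /cp_weight !prod2E /x /y ltnn /slot_command.
have ageE n k : age x y n k t = age (history_requests h) (history_commands h) n k t.
  exact: age_ext.
rewrite !ageE /slot_request; ring.
Qed.

(** Events of the past, encoded as sets closed under equality of histories. Histories take finitely
    many values, so such sets are automatically measurable. *)
Definition determined (t : nat) (A : set Omega) :=
  forall w w', observed_history t w = observed_history t w' -> A w -> A w'.

Lemma determined_measurable t A : determined t A -> measurable A.
Proof.
move=> dA.
pose Q h := exists2 w', A w' & observed_history t w' = h.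
rewrite (_ : A = [set w | Q (observed_history t w)]).
  by apply: fin_measurable_preimage; exact: fin_measurable_history.
by apply/seteqP; split=> [w Aw|w [w' Aw' e]]; [exists w|exact: dA e Aw'].
Qed.

Lemma determinedI t A A' : determined t A -> determined t A' -> determined t (A `&` A').
Proof. by move=> dA dA' w w' e [Aw Aw']; split; [exact: dA e _|exact: dA' e _]. Qed.

Lemma determinedS t A : determined t A -> determined t.+1 A.
Proof.
move=> dA w w' e; apply: dA; apply/ffunP => i; rewrite !ffunE.
have := congr1 (fun h : history t.+1 => h (widen_ord (leqnSn t) i)) e.
by rewrite !ffunE.
Qed.

Lemma determined_AoI t n k (Q : nat -> Prop) : determined t [set w | Q (AoI n k t w)].
Proof. by move=> w w' e /=; rewrite !AoI_history e. Qed.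

Variable n : 'I_2.
Local Notation visit := (in_state beta gamma n).

Lemma determined_visit t (phi : St) : determined t (visit t phi).
Proof. by move=> w w' e H k; rewrite -H !AoI_history e. Qed.

Lemma visit_ex t w : exists phi : St, visit t phi w.
Proof.
have z2 := thr_ge2 hp.
have [k|phi e] := @state_of_ages _ p (fun k => minn (AoI n k t w) z).
  have a0 : (0 < AoI n k t w)%N by case: (t) => // s; rewrite /Defs.AoI /=; case: ifP.
  by rewrite geq_minr andbT leq_min a0 (leq_trans _ z2).
by exists phi => k; rewrite e.
Qed.

Lemma visit_inj t w (phi phi' : St) : visit t phi w -> visit t phi' w -> phi = phi'.
Proof. by move=> H H'; apply: state_ext => k; rewrite -(H k) -(H' k). Qed.

Lemma visit_step t w (phi phi' : St) : visit t phi w -> visit t.+1 phi' w <->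
  forall k, sage phi' k = if received n (observed t w k) then 1%N else grown phi k.
Proof.
move=> H; have z2 := thr_ge2 hp.
suff E k : minn (AoI n k t.+1 w) z =
    if received n (observed t w k) then 1%N else grown phi k.
  by split=> H' k; [rewrite -(H' k) E|rewrite E H'].
rewrite /Defs.AoI /= sum2E /grown -(H k).
rewrite -!observed_request -!observed_command /slot_request /slot_command /received.
rewrite muln_gt0 addn_gt0 !lt0b -/(AoI n k t w).
by case: ifP => _; lia.
Qed.

(** Each history fixes the serving probabilities, and by [serve_min] they depend on it only through
    [phi]; hence all histories give the same factor. [A] is an arbitrary past event so that the step
    can be iterated. *)
Lemma markov_step t A (phi phi' : St) : determined t A ->
  Pr (A `&` visit t phi `&` visit t.+1 phi') =
  (Pr (A `&` visit t phi) * (trans n phi phi')%:E)%E.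
Proof.
move=> dA; have dAp := determinedI dA (@determined_visit t phi).
have mAp := determined_measurable dAp.
have mv := determined_measurable (@determined_visit t.+1 phi').
have mh : fin_measurable (observed_history t) by exact: fin_measurable_history.
rewrite (measure_split Pr mh) ?(measure_split Pr mh mAp); last exact: measurableI.
rewrite ge0_sume_distrl//; apply: eq_bigr => h _.
rewrite setIAC.
(* A history is either incompatible with the event, contributing 0, or contained in it, since the
   event is determined by the history. *)
have [[w0 [w0A w0h]]|no] :=
    pselect (exists w, (A `&` visit t phi `&` [set w | observed_history t w = h]) w);
  last first.
  rewrite (_ : A `&` _ `&` _ = set0) ?set0I ?measure0 ?mul0e//.
  by apply/seteqP; split=> // w Hw; apply: no; exists w.
have {w0 w0A w0h dA dAp mAp} [hE vE] : A `&` visit t phi `&` [set w | observed_history t w = h]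
    = [set w | observed_history t w = h] /\
    forall k, minn (age (history_requests h) (history_commands h) n k t) z = sage phi k.
  split; last by move=> k; rewrite -w0h -AoI_history; case: w0A => _ ->.
  apply/seteqP; split=> [w []//|w Hw]; split=> //.
  by apply: dAp w0A; rewrite w0h Hw.
rewrite hE; pose g k := serve_prob p k
  (age (history_requests h) (history_commands h) n one t)
  (age (history_requests h) (history_commands h) n two t).
have mhh := mh h.
rewrite (measure_split Pr (I := slot) (X := observed t)
  (@fin_measurable_observed t)); last exact: measurableI.
pose wt (c : slot) : R := \prod_k (cp_weight p k (fun n => serve_prob p k
      (age (history_requests h) (history_commands h) n one t)
      (age (history_requests h) (history_commands h) n two t)) (c k) *
      (sage phi' k == if received n (c k) then 1%N else grown phi k)%:R).
have cellE c :
  Pr ([set w | observed_history t w = h] `&` visit t.+1 phi'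
      `&` [set w | observed t w = c])
  = (Pr [set w | observed_history t w = h] * (wt c)%:E)%E.
  have vh w : observed_history t w = h -> visit t phi w.
    by move=> e k; rewrite AoI_history e vE.
  have [ok|nok] := pselect (forall k, sage phi' k = if received n (c k) then 1%N else grown phi k).
    rewrite setIAC (_ : _ `&` visit _ _ =
      [set w | observed_history t w = h] `&` [set w | observed t w = c]).
      rewrite slot_product; congr (_ * _%:E)%E; rewrite /wt; apply: eq_bigr => k _.
      by rewrite ok eqxx mulr1.
    apply/seteqP; split=> [w []//|w [Hh Hc]]; split=> //.
    by apply/(visit_step _ (vh w Hh)) => k; rewrite (Hc : observed t w = c).
  rewrite (_ : _ `&` _ `&` _ = set0); last first.
    apply/seteqP; split=> // w [[Hh Hv] Hc]; apply: nok => k.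
    by move/(visit_step _ (vh w Hh)) : Hv => ->; rewrite (Hc : observed t w = c).
  rewrite measure0 (_ : wt c = 0) ?mule0//.
  apply/eqP/prodf_eq0; move/existsNP : nok => [k /eqP/negPf nk]; exists k => //.
  by rewrite nk mulr0.
rewrite (eq_bigr _ (fun c _ => cellE c)).
have [q ->] : exists q : R, Pr [set w | observed_history t w = h] = q%:E.
  by exists (fine (Pr [set w | observed_history t w = h])); rewrite fineK// fin_num_measure.
transitivity (\sum_c (q * wt c)%:E)%E; first by apply: eq_bigr => c _; rewrite EFinM.
rewrite sumEFin -EFinM; congr (_%:E); rewrite -mulr_sumr; congr (_ * _).
pose F k (x : cp_slot) := cp_weight p k (fun n => serve_prob p k
      (age (history_requests h) (history_commands h) n one t)
      (age (history_requests h) (history_commands h) n two t)) x *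
      (sage phi' k == if received n x then 1%N else grown phi k)%:R.
rewrite -(bigA_distr_bigA F) (trans_prod hp); apply: eq_bigr => k _.
rewrite /F (cp_weight_received _ _ _ _
  (fun b => (sage phi' k == if b then 1%N else grown phi k)%:R)).
by rewrite /rate /serve -!vE serve_min.
Qed.

End Process.

(** * Receptions and ages *)

(** If a first positive [s] with [Q s] exists, the summand is 1 for [j < s] and 0 afterwards;
    otherwise all summands are 1, matching the infimum of the empty set. *)
Lemma ereal_inf_first (R : realType) (Q : nat -> Prop) :
  ereal_inf [set (s%:R : R)%:E | s in [set s : nat | (0 < s)%N /\ Q s]] =
  (\sum_(0 <= j <oo) (`[< forall s, (0 < s <= j)%N -> ~ Q s >]%:R : R)%:E)%E.
Proof.
have [[s1 Qs1]|no] := pselect (exists s, (0 < s)%N /\ Q s); last first.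
  rewrite (_ : image _ _ = set0); last first.
    by apply/seteqP; split=> // x [s Qs _]; apply: no; exists s.
  rewrite ereal_inf0 -(nneseries_one R); apply: eq_eseriesr => j _.
  by rewrite asboolT// => s /andP[s0 _] Qs; apply: no; exists s.
have exQ : exists s, (0 < s)%N && `[< Q s >].
  by exists s1; case: Qs1 => -> /= Q1; apply/asboolP.
have [s /andP[s0 /asboolP Qs] smin] := ex_minnP exQ.
transitivity ((s%:R : R)%:E).
  apply/eqP; rewrite eq_le; apply/andP; split.
    by apply: ereal_inf_lbound; exists s.
  apply/ereal_infP => _ [u [u0 Qu] <-]; rewrite lee_fin ler_nat.
  by apply: smin; rewrite u0; apply/asboolP.
apply/esym; apply: lim_near_cst => //; near=> N.
have sN : (s <= N)%N by near: N; exact: nbhs_infty_ge.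
rewrite (big_cat_nat (leq0n s) sN)//= [X in (_ + X)%E]big_nat_cond.
rewrite [X in (_ + X)%E]big1 ?adde0; last first.
  move=> j /andP[/andP[sj _] _]; rewrite asboolF// => H.
  by apply: (H s) => //; rewrite s0.
rewrite big_nat_cond (eq_bigr (fun=> 1%:E)) => [|j /andP[/andP[_ js] _]].
  by rewrite -big_nat_cond sumEFin sumr_const_nat subn0.
rewrite asboolT// => u /andP[u0 uj] Qu.
have : (s <= u)%N by apply: smin; rewrite u0; apply/asboolP.
lia.
Unshelve. all: by end_near. Qed.

Lemma age_leS b c n k t : (age b c n k t <= t.+1)%N.
Proof. by elim: t => //= t IH; case: ifP. Qed.

(** After time 0 an age is 1 only by a reset, since growth gives at least 2. Requiring [0 < s]
    excludes the initial age 1 at time 0, which is not a reception. *)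
Lemma age_gt b c n k t j : (j <= t)%N ->
  (j < age b c n k t)%N <->
  (forall s, (0 < s <= j)%N -> age b c n k (t - j + s) <> 1%N).
Proof.
elim: t j => [|t IH] [|j] // jt; first by split=> // _ s; lia.
  split=> [_ s|_]; first by lia.
  by rewrite /=; case: ifP.
rewrite ltnS in jt; rewrite subSS; split.
  move=> jage s /andP[s0]; rewrite leq_eqVlt => /orP[/eqP ->|sj].
    by rewrite addnS subnK// => e; rewrite e in jage.
  apply: (IH j jt).1; last by rewrite s0.
  by move: jage => /=; case: ifP.
move=> H; have := H j.+1; rewrite ltnSn addnS subnK// => /(_ isT) /=.
case: ifP => // _ _; rewrite ltnS; apply/(IH j jt) => s /andP[s0 sj].
by apply: H; rewrite s0 ltnW.
Qed.

Section Reception.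
Context {R : realType} (p : nsr_policy R) (B Rmax : R).
Hypothesis hp : valid_policy p B Rmax.
Context {d : measure_display} {Omega : measurableType d} (Pr : probability Omega R).
Context (beta : Omega -> requests) (gamma : Omega -> commands).
Hypothesis hproc : nsr_process p Pr beta gamma.
Variables n k : 'I_2.
Local Notation z := (thr p).
Local Notation St := (state (thr p)).
Local Notation AoI := (AoI beta gamma).
Local Notation visit := (in_state beta gamma n).
Local Notation determined := (determined beta gamma).
Local Notation P := (trans (p := p) n).
Local Notation D := (fun y : St => y \in down z k).

Definition quiet (t j : nat) : set Omega :=
  [set w | forall s, (0 < s <= j)%N -> AoI n k (t + s) w <> 1%N].

Lemma determined_le t u A : (t <= u)%N -> determined t A -> determined u A.
Proof.
move=> /subnK <- dA; elim: (u - t)%N => // i IH.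
by rewrite addSn; exact: determinedS.
Qed.

Lemma determined_quiet t j : determined (t + j) (quiet t j).
Proof.
move=> w w' e H s sj.
have dQ := @determined_AoI _ _ beta gamma (t + s) n k (fun a => a <> 1%N).
have ts : (t + s <= t + j)%N by lia.
by apply: (determined_le ts dQ e); exact: H.
Qed.

Lemma quiet_measurable t j : measurable (quiet t j).
Proof. exact: (determined_measurable hproc (@determined_quiet t j)). Qed.

Lemma visit_measurable t (phi : St) : measurable (visit t phi).
Proof. exact: (determined_measurable hproc (@determined_visit _ p _ _ beta gamma n t phi)). Qed.

Lemma visit_split t A : measurable A ->
  Pr A = (\sum_(phi : St) Pr (A `&` visit t phi))%E.
Proof.
move=> mA; pose X w : St := projT1 (cid (visit_ex hp beta gamma n t w)).
have XE phi : [set w | X w = phi] = visit t phi.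
  apply/seteqP; split=> w; rewrite /X /=; case: cid => phi' v /=; first by move=> <-.
  exact: visit_inj.
rewrite (@measure_split _ _ _ Pr _ X)//; last first.
  by move=> phi; rewrite XE; exact: visit_measurable.
by apply: eq_bigr => phi _; rewrite XE.
Qed.

Lemma visit_down t (phi : St) w : visit t phi w -> (AoI n k t w = 1%N) <-> phi \in down z k.
Proof.
have z2 := thr_ge2 hp.
move=> v; rewrite inE -(v k); split=> [->|/eqP]; last by lia.
by apply/eqP; lia.
Qed.

(** Induction on [j] with one Markov step, after which [A] and the visit to [phi] join the past of
    [t.+1]. Next states in [D] contribute nothing: they mean a reception in the first slot. *)
Lemma markov_quiet t j A (phi : St) : determined t A ->
  Pr (A `&` visit t phi `&` quiet t j) =
  (Pr (A `&` visit t phi) * (survival P D j phi)%:E)%E.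
Proof.
elim: j t A phi => [|j IH] t A phi dA.
  rewrite (_ : quiet t 0 = setT) ?setIT ?mule1//.
  by apply/seteqP; split=> // w _ s; lia.
have dA' := determinedI dA (@determined_visit _ p _ _ beta gamma n t phi).
have mA' := determined_measurable hproc dA'.
set A' := A `&` visit t phi in dA' mA' *.
rewrite (visit_split t.+1); last by apply: measurableI => //; exact: quiet_measurable.
rewrite (bigID D)/= big1 ?add0e => [|psi psiD]; last first.
  rewrite (_ : _ `&` _ = set0) ?measure0//; apply/seteqP; split=> // w [[_ q] v].
  by apply: (q 1) => //; rewrite addn1; apply/(visit_down v).
have [a aE] : exists a : R, Pr A' = a%:E.
  by exists (fine (Pr A')); rewrite fineK// fin_num_measure.
rewrite aE -EFinM mulr_sumr -sumEFin; apply: eq_bigr => psi psiD.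
rewrite mulrA !EFinM -aE -(markov_step hp hproc _ _ _ dA) -/A' -(IH _ _ _ (determinedS dA')).
congr (Pr _); apply/seteqP; split=> w.
  move=> [[A'w q] v]; split=> // s sj.
  by rewrite addSnnS; apply: q; lia.
move=> [[A'w v] q]; split=> //; split=> // -[|[|s]] //.
  by move=> _; rewrite addn1 => /(visit_down v); exact/negP.
by move=> sj; rewrite -addSnnS; apply: q; lia.
Qed.

Lemma visit_quiet t j (phi : St) :
  Pr (visit t phi `&` quiet t j) = (Pr (visit t phi) * (survival P D j phi)%:E)%E.
Proof. by rewrite -[visit t phi]setTI markov_quiet// setTI. Qed.

Lemma recv_time_exit (phi : St) : recv_time n k phi = exit_time P D phi.
Proof. by apply: eq_eseriesr => j _; rewrite no_recv_prob_survival. Qed.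

Lemma recv_delay_series t w :
  recv_delay R beta gamma n k t w = (\sum_(0 <= j <oo) (\1_(quiet t j) w)%:E)%E.
Proof.
rewrite /recv_delay ereal_inf_first; apply: eq_eseriesr => j _.
by rewrite indicE.
Qed.

(** The delay is the sum over [j] of the indicators of [quiet t j], integrated term by term.
    Multiplying by the probability of the visit instead of dividing keeps states of probability 0
    harmless. *)
Lemma recv_delay_integral t (phi : St) :
  (\int[Pr]_(w in visit t phi) recv_delay R beta gamma n k t w
   = recv_time n k phi * Pr (visit t phi))%E.
Proof.
have mv := @visit_measurable t phi.
under eq_integral do rewrite recv_delay_series.
rewrite integral_nneseries//; last first.
  by move=> j; apply/measurable_EFinP; apply: measurable_indic; exact: quiet_measurable.
rewrite recv_time_exit muleC -(fineK (fin_num_measure Pr _ mv)) -nneseriesZl; last first.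
  by move=> j _; rewrite lee_fin survival_ge0//; exact: trans_ge0 hp _.
apply: eq_eseriesr => j _.
rewrite integral_indic//; last exact: quiet_measurable.
by rewrite setIC fineK ?fin_num_measure//; exact: visit_quiet.
Qed.

Definition visit_law (t : nat) (phi : St) : R := fine (Pr (visit t phi)).

Lemma visit_lawE t phi : Pr (visit t phi) = (visit_law t phi)%:E.
Proof. by rewrite fineK// fin_num_measure//; exact: visit_measurable. Qed.

Lemma visit_law_sum1 t : \sum_phi visit_law t phi = 1.
Proof.
apply: EFin_inj; rewrite -sumEFin -(probability_setT Pr) (visit_split t)//.
by apply: eq_bigr => phi _; rewrite setTI visit_lawE.
Qed.

Lemma visit_law_step t psi :
  visit_law t.+1 psi = \sum_phi visit_law t phi * P phi psi.
Proof.
apply: EFin_inj; rewrite -visit_lawE -sumEFin (visit_split t); last exact: visit_measurable.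
apply: eq_bigr => phi _; rewrite EFinM -visit_lawE -[visit t phi]setTI.
by rewrite -(markov_step hp hproc)// setTI setIC.
Qed.

(** An age counts the naturals [j] below it, and an age of at most [t.+1] ensures that those up to
    [t] are all of them. *)
Lemma AoI_indic t w :
  (AoI n k t w)%:R = \sum_(j < t.+1) \1_(quiet (t - j) j) w :> R.
Proof.
rewrite -(subnKC (age_leS (beta w) (gamma w) n k t)) -/(AoI n k t w).
set a := AoI n k t w; rewrite -{1}[a]card_ord -sum1_card natr_sum.
pose f j : R := (j < a)%:R.
transitivity (\sum_(j < t.+1) f j); last first.
  rewrite subnKC ?age_leS//; apply: eq_bigr => j _; rewrite indicE /f; congr ((nat_of_bool _)%:R).
  have jt : (j <= t)%N by rewrite -ltnS.
  apply/idP/idP => [/(age_gt _ _ _ _ jt) H|]; first by rewrite inE.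
  by rewrite inE => H; apply/(age_gt _ _ _ _ jt).
rewrite (big_ord_widen _ (fun=> 1) (age_leS (beta w) (gamma w) n k t)).
by rewrite big_mkcond; apply: eq_bigr => j _; rewrite /f; case: ltnP.
Qed.

Lemma expectation_AoI t :
  ('E_Pr [fun w => (AoI n k t w)%:R] = (mean_age P D visit_law t)%:E)%E.
Proof.
rewrite unlock /=.
under eq_integral do rewrite AoI_indic -sumEFin.
rewrite ge0_integral_sum//; last first.
  by move=> j; apply/measurable_EFinP; apply: measurable_indic; exact: quiet_measurable.
rewrite -sumEFin; apply: eq_bigr => j _.
have mq := @quiet_measurable (t - j) j.
rewrite integral_indic// setIT.
apply: etrans (visit_split (t - j) mq) _; rewrite -sumEFin.
by apply: eq_bigr => phi _; rewrite setIC visit_quiet visit_lawE EFinM.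
Qed.

End Reception.

(** * Passage to the long-run average AoI *)

Lemma mean_AoI_cvg (R : realType) (p : nsr_policy R) (B Rmax : R)
    (hp : valid_policy p B Rmax)
    (d : measure_display) (Omega : measurableType d) (Pr : probability Omega R)
    (beta : Omega -> requests) (gamma : Omega -> commands)
    (hproc : nsr_process p Pr beta gamma)
    (pi : 'I_2 -> {ffun state (thr p) -> R}) :
  (forall n, steady_state n (pi n)) ->
  mean_AoI Pr beta gamma T @[T --> \oo] -->
     ((4^-1)%:E * \sum_(n < 2) \sum_(k < 2) \sum_(phi : state (thr p))
        recv_time n k phi * (pi n phi)%:E)%E.
Proof.
move=> st.
pose e n k t := mean_age (trans (p := p) n) (fun y => y \in down (thr p) k)
  (visit_law (p := p) Pr beta gamma n) t.
pose a n k N : \bar R := (N%:R^-1 * \sum_(t < N) e n k t.+1)%:E.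
have -> : mean_AoI Pr beta gamma = fun N => ((4^-1)%:E * \sum_(n < 2) \sum_(k < 2) a n k N)%E.
  apply/funext => N; rewrite /mean_AoI.
  under eq_bigr do under eq_bigr do under eq_bigr do rewrite (expectation_AoI hp hproc).
  rewrite big_add1 big_mkord.
  under eq_bigr do rewrite !sum2E -!EFinD -EFinM.
  rewrite sumEFin -EFinM !sum2E -!EFinD -EFinM -mulr_sumr !big_split /=.
  by congr (_%:E); rewrite /e; ring.
have lim n k : a n k N @[N --> \oo] -->
    (\sum_(phi : state (thr p)) recv_time n k phi * (pi n phi)%:E)%E.
  have [star to_star] := star_exists hp n.
  have [pi0 pi1 pi_inv] := st n.
  under eq_bigr do rewrite recv_time_exit.
  have law0 t phi : 0 <= visit_law (p := p) Pr beta gamma n t phi by exact: fine_ge0.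
  exact: (mean_age_cvg (trans_ge0 hp n) (trans_sum1 hp n) to_star pi0 pi1 pi_inv
    law0 (visit_law_sum1 hp hproc n) (visit_law_step hp hproc n)).
(* Nonnegativity makes the sums of possibly infinite limits well defined. *)
have pos n k : (0 <= \sum_(phi : state (thr p)) recv_time n k phi * (pi n phi)%:E)%E.
  apply: sume_ge0 => phi _; rewrite mule_ge0 ?lee_fin//; last by case: (st n).
  by rewrite recv_time_exit exit_time_ge0//; exact: trans_ge0 hp n.
apply: cvgeZl => //; rewrite !sum2E; under eq_fun do rewrite !sum2E.
by do 2?[apply: cvgeD; rewrite ?ge0_adde_def ?inE ?adde_ge0//].
Qed.

Theorem theorem4 (R : realType) (p : nsr_policy R) (B Rmax : R)
    (hp : valid_policy p B Rmax)
    (d : measure_display) (Omega : measurableType d) (Pr : probability Omega R)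
    (beta : Omega -> requests) (gamma : Omega -> commands)
    (hproc : nsr_process p Pr beta gamma) :
  (* the steady-state distribution determined by the transition matrix *)
  (forall n : 'I_2, exists! pi : {ffun state (thr p) -> R}, steady_state n pi) /\
  (* F_{nk}(phi) is the expected time until the next reception given phi *)
  (forall (n k : 'I_2) (t : nat) (phi : state (thr p)),
     (\int[Pr]_(w in in_state beta gamma n t phi) recv_delay R beta gamma n k t w
      = recv_time n k phi * Pr (in_state beta gamma n t phi))%E) /\
  (* F_{nk} is given by the linear system *)
  (forall n k : 'I_2,
     recv_system n k (recv_time (p := p) n k) /\
     (forall f : state (thr p) -> R, recv_system n k (fun phi => (f phi)%:E) ->
        forall phi, recv_time n k phi = (f phi)%:E)) /\
  (* L_e *)
  (forall pi : 'I_2 -> {ffun state (thr p) -> R},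
     (forall n, steady_state n (pi n)) ->
     mean_AoI Pr beta gamma T @[T --> \oo] -->
     ((4^-1)%:E * \sum_(n < 2) \sum_(k < 2) \sum_(phi : state (thr p))
        recv_time n k phi * (pi n phi)%:E)%E).
Proof.
split; [|split; [|split]].
- move=> n; have [star to_star] := star_exists hp n.
  have [v [v0 v1 v_inv]] := stationary_exists (trans_ge0 hp n) (trans_sum1 hp n) star.
  exists (finfun v); split.
    split=> [phi||psi]; first by rewrite ffunE.
      by under eq_bigr do rewrite ffunE.
    by under eq_bigr do rewrite ffunE; rewrite ffunE v_inv.
  move=> pi [pi0 pi1 pi_inv]; apply/ffunP => phi; rewrite ffunE; apply/esym.
  exact: (invariant_unique (trans_ge0 hp n) (trans_sum1 hp n) to_star v1 v_inv).
- by move=> n k t phi; exact: (recv_delay_integral hp hproc).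
- move=> n k; split=> [phi|f fE phi]; rewrite !recv_time_exit.
    rewrite (exit_time_system _ (trans_ge0 hp n)); congr (1 + _)%E.
    by apply: eq_bigr => psi _; rewrite recv_time_exit.
  apply: (exit_time_first_step (trans_ge0 hp n) (trans_sum1 hp n)) => psi.
  apply: EFin_inj; rewrite (fE psi) EFinD; congr (_ + _)%E.
  by rewrite -sumEFin; apply: eq_bigr => psi' _; rewrite EFinM.
- by move=> pi; exact: (mean_AoI_cvg hp hproc).
Qed.
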